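(* There is an algorithm that, given any $\mathcal{T}_7$-free tournament $T'=(V',A')$ with weight function $w:V'\to\mathbb{Q}_{\ge 0}$, finds in polynomial time a feedback vertex set $F'$ of $T'$ with $w(F')\le \frac{7}{9}\,w(V')$.
   Context: A tournament is an orientation of a complete graph; it is transitive if it contains no directed cycle. A feedback vertex set (FVS) of a tournament $T=(V,A)$ is a set $S\subseteq V$ such that $T[V\setminus S]$ is transitive. $\mathcal{T}_7$ denotes the family of tournaments on $7$ vertices that contain no transitive subtournament on $5$ vertices (equivalently, every FVS of them has size at least $3$). A tournament is $\mathcal{T}_7$-free if it has no $7$-vertex subtournament isomorphic to a member of $\mathcal{T}_7$. For $S\subseteq V'$, $w(S)=\sum_{v\in S}w(v)$. *)

(* Defs.v *)
From HB Require Import structures.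
From mathcomp Require Import all_boot all_order all_algebra.

Set Implicit Arguments.
Unset Strict Implicit.
Unset Printing Implicit Defensive.

Import GRing.Theory Num.Theory.

Record tournament (V : finType) := Tournament {
  arc :> rel V;
  arc_irreflexive : irreflexive arc;
  arc_orientation : forall x y, x != y -> arc x y (+) arc y x }.

Definition transitive_tournament (V : finType) (T : tournament V) : Prop :=
  ~ exists2 c : seq V, c != [::] & ucycle T c.

Section Induced.
Variables (V : finType) (T : tournament V) (S : {set V}).

Let induced_arc : rel {x : V | x \in S} := fun x y => T (val x) (val y).

Fact induced_irreflexive : irreflexive induced_arc.
Proof. by move=> x; apply: arc_irreflexive. Qed.

Fact induced_orientation x y :
  x != y -> induced_arc x y (+) induced_arc y x.
Proof. by move=> nxy; apply: arc_orientation; rewrite (inj_eq val_inj). Qed.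

Definition induced : tournament {x : V | x \in S} :=
  Tournament induced_irreflexive induced_orientation.

End Induced.

Definition feedback_vertex_set (V : finType) (T : tournament V) (S : {set V}) :=
  transitive_tournament (induced T (~: S)).

Definition isomorphic (U V : finType) (T : tournament U) (T' : tournament V) :=
  exists2 f : U -> V, bijective f & forall x y, T' (f x) (f y) = T x y.

Definition in_T7 (V : finType) (T : tournament V) : Prop :=
  #|V| = 7 /\
  forall S : {set V}, #|S| = 5 -> ~ transitive_tournament (induced T S).

Definition T7_free (V : finType) (T : tournament V) : Prop :=
  forall (U : finType) (T' : tournament U), in_T7 T' ->
  forall S : {set V}, #|S| = 7 -> ~ isomorphic (induced T S) T'.

Definition weight (V : finType) (w : V -> rat) (S : {set V}) : rat :=
  (\sum_(v in S) w v)%R.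

(** Polynomial time is measured on a random access machine under the
    logarithmic cost criterion (Aho, Hopcroft and Ullman), which is polynomially
    equivalent to a Turing machine.  Programs are structured (while loops
    instead of jumps), and the memory is split into arrays: a program mentions
    finitely many of them, by literal names, while the indices are computed at
    run time. *)

Definition memory := nat -> nat -> nat.

Inductive binop := Add | Sub | Mul | Div | Leq | Eqn.

Definition eval_binop (o : binop) : nat -> nat -> nat :=
  match o with
  | Add => addn
  | Sub => subn
  | Mul => muln
  | Div => divn
  | Leq => fun m n => nat_of_bool (m <= n)
  | Eqn => fun m n => nat_of_bool (m == n)
  end.

Inductive expr :=
  | Const of nat
  | Get of nat & expr
  | Bin of binop & expr & expr.

Inductive cmd :=
  | Skip
  | Set_ of nat & expr & expr
  | Seq of cmd & cmd
  | If of expr & cmd & cmd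
  | While of expr & cmd.

Fixpoint eval (m : memory) (e : expr) : nat :=
  match e with
  | Const n => n
  | Get a i => m a (eval m i)
  | Bin o e1 e2 => eval_binop o (eval m e1) (eval m e2)
  end.

(** Length of the binary representation; [bits 0 = 0]. *)
Definition bits (n : nat) : nat := up_log 2 n.+1.

(** Every node pays for the length of its value; operands and addresses are
    thereby paid for by the subexpressions that compute them. *)
Fixpoint expr_cost (m : memory) (e : expr) : nat :=
  (bits (eval m e)).+1 +
  match e with
  | Const _ => 0
  | Get _ i => expr_cost m i
  | Bin _ e1 e2 => expr_cost m e1 + expr_cost m e2
  end.

Definition update (m : memory) (a i v : nat) : memory :=
  fun b j => if (b == a) && (j == i) then v else m b j.

(** [exec c m m' t]: started in [m], the program [c] halts in [m'] at cost
    [t]. *)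
Inductive exec : cmd -> memory -> memory -> nat -> Prop :=
  | ExecSkip m : exec Skip m m 1
  | ExecSet a i e m :
      exec (Set_ a i e) m (update m a (eval m i) (eval m e))
           (expr_cost m i + expr_cost m e).+1
  | ExecSeq c1 c2 m1 m2 m3 t1 t2 :
      exec c1 m1 m2 t1 -> exec c2 m2 m3 t2 ->
      exec (Seq c1 c2) m1 m3 (t1 + t2).+1
  | ExecIfTrue e c1 c2 m m' t :
      eval m e != 0 -> exec c1 m m' t ->
      exec (If e c1 c2) m m' (expr_cost m e + t).+1
  | ExecIfFalse e c1 c2 m m' t :
      eval m e = 0 -> exec c2 m m' t ->
      exec (If e c1 c2) m m' (expr_cost m e + t).+1
  | ExecWhileTrue e c m1 m2 m3 t1 t2 :
      eval m1 e != 0 -> exec c m1 m2 t1 -> exec (While e c) m2 m3 t2 ->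
      exec (While e c) m1 m3 (expr_cost m1 e + t1 + t2).+1
  | ExecWhileFalse e c m :
      eval m e = 0 -> exec (While e c) m m (expr_cost m e).+1.

Definition load (s : seq (seq nat)) : memory :=
  fun a i => nth 0 (nth [::] s a) i.

Definition input_size (s : seq (seq nat)) : nat :=
  \sum_(r <- s) \sum_(n <- r) (bits n).+1.

(** The vertices are numbered by their position in [enum V]; the adjacency
    matrix is stored by rows. *)
Definition encode (V : finType) (T : tournament V) (w : V -> rat) :
    seq (seq nat) :=
  [:: [:: #|V| ];
      [seq nat_of_bool (T x y) | x <- enum V, y <- enum V];
      [seq absz (numq (w x)) | x <- enum V];
      [seq absz (denq (w x)) | x <- enum V] ].

(** The output is the characteristic vector stored in array 4. *)
Definition output (V : finType) (m : memory) : {set V} :=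
  [set x : V | m 4 (index x (enum V)) != 0].

(* Main.v *)
From HB Require Import structures.
From mathcomp Require Import all_boot all_order all_algebra.
From mathcomp Require Import zify lra.
Require Import Defs.

Set Implicit Arguments.
Unset Strict Implicit.
Unset Printing Implicit Defensive.

(** Call a vertex set k-bounded if every 2k+1 of its vertices contain k+2 that
    span a transitive tournament; a T7-free tournament is 3-bounded, and 1-bounded
    means transitive.  Let k <= 3 and let the tournament be k-bounded.  Then the
    second out-neighbourhood of a vertex u is (k-1)-bounded, since otherwise u
    and an induced matching of k arcs would violate k-boundedness; so is
    N^+(v) :&: N^-(d) whenever v is reached from d in at most two steps.

    Starting at a vertex v of minimum out-degree, put v and N^+(v) aside as one
    piece, and its second out-neighbourhood J as another.  In the rest, which
    dominates v and N^+(v), take as next pivot a king of the third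
    out-neighbourhood, and so on.  All the pieces are 2-bounded.  The union of the
    pieces of the first kind, that of the even J's and that of the odd J's are
    ordered sums of such pieces, hence 2-bounded: three parts.

    In a 2-bounded part, the distance layers from a vertex of minimum out-degree
    have the property that each triangle meets three consecutive layers, so that
    deleting the layers in one class modulo 3 makes the part transitive.  Each
    vertex is kept by two of the nine resulting sets, so the heaviest of these
    weighs at least 2/9 of the total. *)

(** * Obstructions *)

(** The restriction k <= 3 comes from a covering count. Let an obstruction on 2k+1 vertices dominate
    u and be covered by out-neighbours of u inside a (k+1)-bounded set. Each of these covers at most
    k of its vertices, so a minimal cover has at least three members, and their private vertices
    give an induced matching. A contradiction takes k+1 matching arcs, which three members guarantee
    only for k+1 <= 3.

    Pieces can be summed only if all arcs between them point one way. The choice of a king forces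
    every vertex that receives an arc from the previous J to be placed in the next round, so only
    the latest J has arcs into the rest. Hence successive J's are kept in different parts, while J's
    two rounds apart form an ordered sum. When J reaches nothing new, the rest dominates all that is
    placed and a vertex of minimum out-degree starts afresh; the layers restart in the same way.

    Running time is obtained from the syntax of the program alone: every loop has a bound that its
    body leaves unchanged, and all stored values stay below 2^b with b linear in the input size. *)

Section Converse.
Variables (V : finType) (T : tournament V).

Fact converse_irreflexive : irreflexive (fun x y => T y x).
Proof. exact: arc_irreflexive. Qed.

Fact converse_orientation x y : x != y -> T y x (+) T x y.
Proof. by rewrite addbC; apply: arc_orientation. Qed.

Definition converse : tournament V :=
  Tournament converse_irreflexive converse_orientation.

End Converse.

Section Tournaments.
Variables (V : finType).
Implicit Types (T : tournament V) (S X Y D A B : {set V}) (x y z d u v : V).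

Lemma arcN T x y : x != y -> ~~ T x y -> T y x.
Proof. by move/(arc_orientation T); case: (T x y); case: (T y x). Qed.

Lemma arc_asym T x y : T x y -> T y x -> False.
Proof.
move=> xy yx; have [e|/(arc_orientation T)] := eqVneq x y; last by rewrite xy yx.
by move: xy; rewrite e arc_irreflexive.
Qed.

Lemma arc_neq T x y : T x y -> x != y.
Proof. by move=> xy; apply: contraTneq xy => ->; rewrite arc_irreflexive. Qed.

(** Transitivity on triples is decidable and, in a tournament, amounts to the absence of directed
    cycles, since a shortest one is a triangle. *)
Definition acyclic T S :=
  [forall x in S, forall y in S, forall z in S, T x y ==> T y z ==> T x z].

Lemma acyclicP T S :
  reflect (forall x y z, x \in S -> y \in S -> z \in S -> T x y -> T y z -> T x z)
          (acyclic T S).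
Proof.
apply: (iffP idP) => [H x y z xS yS zS xy yz|H].
  by move/forall_inP/(_ x xS)/forall_inP/(_ y yS)/forall_inP/(_ z zS): H;
     rewrite xy yz.
apply/forall_inP=> x xS; apply/forall_inP=> y yS; apply/forall_inP=> z zS.
by apply/implyP=> xy; apply/implyP=> yz; apply: H yz.
Qed.

Lemma acyclicS T S S' : S' \subset S -> acyclic T S -> acyclic T S'.
Proof.
move/subsetP=> s /acyclicP H; apply/acyclicP=> x y z /s xS /s yS /s zS.
exact: H.
Qed.

Lemma acyclic_triangle T S x y z : acyclic T S -> x \in S -> y \in S -> z \in S ->
  T x y -> T y z -> T z x -> False.
Proof. by move/acyclicP=> H xS yS zS xy yz; apply: arc_asym; apply: H yz. Qed.

Lemma acyclicI T S :
  (forall x y z, x \in S -> y \in S -> z \in S -> T x y -> T y z -> T z x -> False) ->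
  acyclic T S.
Proof.
move=> H; apply/acyclicP=> x y z xS yS zS xy yz.
apply: arcN; first by apply: contraTneq xy => <-; apply/negP=> /(arc_asym yz).
by apply/negP=> zx; exact: (H x y z).
Qed.

Lemma acyclic_converse T S : acyclic (converse T) S = acyclic T S.
Proof.
by apply/acyclicP/acyclicP=> H x y z xS yS zS xy yz; apply: (H z y x).
Qed.

(** Equivalently, any 2k+1 vertices of [S] have a feedback vertex set of k-1 vertices. *)
Definition fvs_bounded T k S :=
  forall X, X \subset S -> #|X| = k.*2.+1 ->
  exists Y, [/\ Y \subset X, #|Y| = k.+2 & acyclic T Y].

(** For k = 3 these span the members of T7, and for k = 1 they are the directed triangles. *)
Definition obstruction T k X :=
  #|X| = k.*2.+1 /\ forall Y, Y \subset X -> #|Y| = k.+2 -> ~~ acyclic T Y.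

Lemma fvs_boundedI T k S :
  (forall X, X \subset S -> obstruction T k X -> False) -> fvs_bounded T k S.
Proof.
move=> H X XS cX.
have [/existsP[Y /and3P[? /eqP ? ?]]|/existsPn no] :=
  boolP [exists Y : {set V}, [&& Y \subset X, #|Y| == k.+2 & acyclic T Y]].
  by exists Y.
case: (H X XS); split=> // Y YX cY; apply/negP=> aY.
by move: (no Y); rewrite YX cY eqxx aY.
Qed.

Lemma fvs_bounded_converse T k S : fvs_bounded T k S -> fvs_bounded (converse T) k S.
Proof.
by move=> H X XS cX; have [Y [? ? aY]] := H X XS cX; exists Y;
   rewrite acyclic_converse.
Qed.

Lemma obstruction_converse T k X : obstruction T k X -> obstruction (converse T) k X.
Proof. by move=> [cX H]; split=> // Y YX cY; rewrite acyclic_converse H. Qed.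

Lemma fvs_bounded1 T S : fvs_bounded T 1 S -> acyclic T S.
Proof.
move=> H; apply: acyclicI=> x y z xS yS zS xy yz zx.
have cX : #|[set x; y; z]| = 3.
  by rewrite setUC cardsU1 cards2 !inE negb_or (arc_neq zx) (arc_neq xy) eq_sym (arc_neq yz).
have [|Y [YX cY aY]] := H [set x; y; z] _ cX.
  by apply/subsetP=> t; rewrite !inE => /orP[/orP[]|] /eqP ->.
have eY : Y = [set x; y; z] by apply/eqP; rewrite eqEcard YX cX cY.
by apply: (acyclic_triangle aY _ _ _ xy yz zx); rewrite eY !inE eqxx ?orbT.
Qed.

Lemma subset_of_card S k : k <= #|S| -> exists2 Y : {set V}, Y \subset S & #|Y| = k.
Proof.
elim: k => [|k IHk] leS; first by exists set0; rewrite ?sub0set ?cards0.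
have [Y YS cY] := IHk (ltnW leS).
have : S :\: Y != set0.
  by rewrite -card_gt0 cardsD (setIidPr YS) cY subn_gt0.
case/set0Pn=> x; rewrite inE => /andP[xY xS]; exists (x |: Y).
  by rewrite subUset sub1set xS.
by rewrite cardsU1 xY cY.
Qed.

Section Obstructions.
Variables (T : tournament V) (k : nat) (S X : {set V}).
Hypotheses (bS : fvs_bounded T k.+1 S) (XS : X \subset S) (oX : obstruction T k X).

(** Among the 2k+3 vertices of [X] with [p] and [q] there are k+3 acyclic ones. At most k+1 of them
    lie in [X], so both [p] and [q] are used. *)
Lemma obstruction_pair p q : p \in S -> q \in S -> p \notin X -> q \notin X ->
  p != q ->
  exists Y, [/\ Y \subset X, #|Y| = k.+1 & acyclic T (p |: (q |: Y))].
Proof.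
move=> pS qS pX qX pq; case: (oX) => cX noX.
have [||Y [YU cY aY]] := bS (X := p |: (q |: X)).
- by rewrite !subUset !sub1set pS qS XS.
- by rewrite !cardsU1 !inE negb_or pq pX qX cX; lia.
have cYX : #|Y :&: X| <= k.+1.
  rewrite leqNgt; apply/negP=> /subset_of_card[Z ZYX cZ].
  move: (noX Z); rewrite (subset_trans ZYX (subsetIr _ _)) cZ => /(_ isT erefl).
  by rewrite (acyclicS (subset_trans ZYX (subsetIl _ _)) aY).
have YE : Y \subset p |: (q |: (Y :&: X)).
  apply/subsetP=> y yY; move/subsetP/(_ y yY): YU; rewrite !inE yY /=.
  by [].
have cR : #|p |: (q |: (Y :&: X))| = #|Y :&: X|.+2.
  by rewrite !cardsU1 !inE negb_or pq (negbTE pX) (negbTE qX) !andbF.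
have cYX' : #|Y :&: X| = k.+1.
  by move: (subset_leq_card YE); rewrite cR cY => ?; lia.
have eY : Y = p |: (q |: (Y :&: X)) by apply/eqP; rewrite eqEcard YE cR cYX' cY leqnn.
by exists (Y :&: X); split; rewrite -?eY ?subsetIr.
Qed.

Lemma no_obstruction_arc d v : d \in S -> v \in S -> T d v ->
  (forall x, x \in X -> T x d) -> (forall x, x \in X -> T v x) -> False.
Proof.
move=> dS vS dv Xd vX.
have dX : d \notin X by apply/negP=> /Xd; rewrite arc_irreflexive.
have vX' : v \notin X by apply/negP=> /vX; rewrite arc_irreflexive.
have [Y [YX cY aY]] := obstruction_pair dS vS dX vX' (arc_neq dv).
have /set0Pn[x xY] : Y != set0 by rewrite -card_gt0 cY.
have xX := subsetP YX x xY.
apply: (acyclic_triangle aY) (vX x xX) (Xd x xX) dv;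
  by rewrite !inE ?xY ?eqxx ?orbT.
Qed.

(** Each of the k+1 vertices x of [X] that are acyclic together with [d] and [y] satisfies x -> d ->
    y, hence x -> y. *)
Lemma obstruction_into d y : d \in S -> y \in S -> T d y ->
  (forall x, x \in X -> T x d) -> k < #|[set x in X | T x y]|.
Proof.
move=> dS yS dy Xd.
have dX : d \notin X by apply/negP=> /Xd; rewrite arc_irreflexive.
have yX : y \notin X by apply/negP=> /Xd /(arc_asym dy).
have [Y [YX cY aY]] := obstruction_pair dS yS dX yX (arc_neq dy).
rewrite -cY; apply/subset_leq_card/subsetP=> x xY; rewrite inE.
have xX := subsetP YX x xY; rewrite xX /=.
by move/acyclicP: aY => /(_ x d y); apply; rewrite ?inE ?xY ?eqxx ?orbT ?Xd.
Qed.

End Obstructions.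

Lemma obstruction_outof T k S X y v : fvs_bounded T k.+1 S -> X \subset S ->
  obstruction T k X -> y \in S -> v \in S -> T y v ->
  (forall x, x \in X -> T v x) -> k < #|[set x in X | T y x]|.
Proof.
move=> /fvs_bounded_converse bS XS /obstruction_converse oX yS vS yv vX.
exact: (obstruction_into bS XS oX vS yS).
Qed.

(** At least k+1 vertices of [X] dominate [y] and at least k+1 others are dominated by it, too many
    for 2k+1. *)
Lemma no_obstruction_path T k S X d y v : fvs_bounded T k.+1 S -> X \subset S ->
  obstruction T k X -> d \in S -> y \in S -> v \in S -> T d y -> T y v ->
  (forall x, x \in X -> T x d) -> (forall x, x \in X -> T v x) -> False.
Proof.
move=> bS XS oX dS yS vS dy yv Xd vX.
have inY := obstruction_into bS XS oX dS yS dy Xd.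
have outY := obstruction_outof bS XS oX yS vS yv vX.
have : #|[set x in X | T x y] :|: [set x in X | T y x]| <= #|X|.
  by apply/subset_leq_card/subsetP=> x; rewrite !inE => /orP[]/andP[].
have /eqP I0 : [set x in X | T x y] :&: [set x in X | T y x] == set0.
  apply/set0Pn=> -[x]; rewrite !inE => /andP[/andP[_ xy] /andP[_ yx]].
  exact: arc_asym xy yx.
by rewrite cardsU I0 cards0 (proj1 oX); lia.
Qed.

Section Matching.
Variables (T : tournament V) (k : nat) (S : {set V}).
Hypothesis bS : fvs_bounded T k.+1 S.

(* Deleting fewer than k.+1 vertices leaves a cycle: if u is kept, one of the
   k.+1 triangles through u survives; if u is deleted, two matching arcs survive
   and close up to a cycle of length 4. *)
Lemma no_induced_matching u D (g : V -> V) :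
  u \in S -> D \subset S -> (forall d, d \in D -> g d \in S) ->
  #|D| = k.+1 ->
  (forall d, d \in D -> [/\ T u d, T d (g d) & T (g d) u]) ->
  (forall d d', d \in D -> d' \in D -> d != d' -> T (g d) d') -> False.
Proof.
move=> uS DS gS cD uDg priv.
have gD d d' : d \in D -> d' \in D -> g d != d'.
  move=> dD d'D; case/uDg: (dD) => _ _ gu; case/uDg: (d'D) => ud' _ _.
  by apply/eqP=> e; rewrite e in gu; apply: arc_asym gu ud'.
have ginj : {in D &, injective g}.
  move=> d d' dD d'D e; apply/eqP; apply/negPn/negP=> nd.
  case/uDg: (d'D) => _ dg _; have := priv d d' dD d'D nd; rewrite e.
  exact: arc_asym dg.
have cgD : #|g @: D| = k.+1 by rewrite card_in_imset.
have uD : u \notin D by apply/negP=> /uDg[]; rewrite arc_irreflexive.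
have ugD : u \notin g @: D.
  apply/negP=> /imsetP[d dD e]; case/uDg: dD => _ _; rewrite -e.
  by rewrite arc_irreflexive.
have I0 : D :&: g @: D = set0.
  apply/eqP/set0Pn=> -[x]; rewrite inE => /andP[xD /imsetP[d dD e]].
  by move: (gD d x dD xD); rewrite e eqxx.
have [||Y [YU cY aY]] := bS (X := u |: (D :|: g @: D)).
- rewrite !subUset sub1set uS DS; apply/subsetP=> x /imsetP[d dD ->].
  exact: gS.
- by rewrite cardsU1 cardsU I0 cards0 cgD cD inE negb_or uD ugD; lia.
pose A := [set d in D | d \in Y]; pose B := [set d in D | g d \in Y].
have cAB : #|Y| <= (u \in Y) + #|A| + #|B|.
  have -> : #|B| = #|g @: B|.
    rewrite card_in_imset // => d d'; rewrite !inE => /andP[dD _] /andP[d'D _].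
    exact: ginj.
  have : #|Y| <= #|(if u \in Y then [set u] else set0) :|: (A :|: g @: B)|.
    apply/subset_leq_card/subsetP=> x xY; move/subsetP/(_ x xY): YU.
    rewrite !inE => /orP[/eqP e|/orP[xD|/imsetP[d dD e]]].
    - by rewrite -e xY inE eqxx.
    - by rewrite xD xY /= orbT.
    - by rewrite e imset_f ?orbT // inE dD -e.
  move/leq_trans; apply; rewrite (leq_trans (leq_card_setU _ _)) //.
  rewrite -addnA leq_add //; first by case: ifP; rewrite ?cards1 ?cards0.
  exact: leq_card_setU.
have cU : #|A :|: B| <= k.+1.
  by rewrite -cD; apply/subset_leq_card/subsetP=> x; rewrite !inE => /orP[]/andP[].
have := cardsUI A B; case uY: (u \in Y) in cAB => cUI.
  have /eqP I0' : A :&: B == set0.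
    apply/set0Pn=> -[d]; rewrite !inE => /andP[/andP[dD dY] /andP[_ gY]].
    by case/uDg: dD => ud dg; apply: (acyclic_triangle aY) dg.
  by move: cUI; rewrite I0' cards0; lia.
have : 1 < #|A :&: B| by lia.
case/card_gt1P=> d [d' []]; rewrite !inE.
move=> /andP[/andP[dD dY] /andP[_ gY]] /andP[/andP[d'D d'Y] /andP[_ gY']] nd.
have [_ dg _] := uDg d dD; have [_ dg' _] := uDg d' d'D.
move/acyclicP: aY => aY.
have dd' := aY d (g d) d' dY gY d'Y dg (priv d d' dD d'D nd).
apply: (arc_asym dd'); apply: (aY d' (g d') d) => //.
by apply: priv => //; rewrite eq_sym.
Qed.

(** In an inclusion-minimal set of out-neighbours of [u] covering [X], each member has a private
    vertex in [X]; these pairs form an induced matching whose arcs all lie on triangles through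
    [u]. *)
Lemma no_obstruction_second X u : k <= 2 -> X \subset S -> obstruction T k X ->
  u \in S -> (forall x, x \in X -> T x u) ->
  (forall x, x \in X -> exists d, [/\ d \in S, T u d & T d x]) -> False.
Proof.
move=> k2 XS oX uS Xu cov.
pose P D := [&& D \subset S, [forall d in D, T u d] &
                [forall x in X, exists d in D, T d x]].
have P0 : P [set d in S | T u d].
  apply/and3P; split; first by apply/subsetP=> x; rewrite inE => /andP[].
    by apply/forall_inP=> x; rewrite inE => /andP[].
  apply/forall_inP=> x /cov[d [dS ud dx]]; apply/exists_inP.
  by exists d; rewrite // inE dS.
have [D /minsetP[/and3P[DS /forall_inP uD /forall_inP Dcov] Dmin] _] := minset_exists P0.
pose cover d := [set x in X | T d x].
have cardcover d : d \in D -> #|cover d| <= k.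
  move=> dD; have := obstruction_into bS XS oX uS (subsetP DS d dD) (uD d dD) Xu.
  have : #|cover d :|: [set x in X | T x d]| <= #|X|.
    by apply/subset_leq_card/subsetP=> x; rewrite !inE => /orP[]/andP[].
  have /eqP I0 : cover d :&: [set x in X | T x d] == set0.
    apply/set0Pn=> -[x]; rewrite !inE => /andP[/andP[_ xy] /andP[_ yx]].
    exact: arc_asym xy yx.
  by rewrite cardsU I0 cards0 (proj1 oX); lia.
(* Two members cover at most 2k of the 2k+1 vertices. With k <= 2 the three members obtained here
   are at least k+1. *)
have D3 : 2 < #|D|.
  have : #|X| <= \sum_(d in D) #|cover d|.
    have /subset_leq_card/leq_trans : X \subset \bigcup_(d in D) cover d.
      apply/subsetP=> x xX; have /exists_inP[d dD dx] := Dcov x xX.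
      by apply/bigcupP; exists d; rewrite // inE xX.
    apply; elim/big_rec2: _ => [|d m C _ ih]; first by rewrite cards0.
    exact: leq_trans (leq_card_setU _ _) (leq_add (leqnn _) ih).
  have : \sum_(d in D) #|cover d| <= \sum_(d in D) k by apply: leq_sum.
  by rewrite sum_nat_const (proj1 oX); case: (#|D|) => [|[|[|?]]] //; lia.
(* Without a vertex covered by [d] alone, [D :\ d] would still cover [X], against minimality. *)
have privE d : d \in D ->
    exists x, [&& x \in X, T d x & [forall d' in D, (d' != d) ==> T x d']].
  move=> dD; apply/existsP; apply: contraT => /existsPn no.
  have : D :\ d = D.
    apply: Dmin; last exact: subsetDl.
    apply/and3P; split; first exact: subset_trans (subsetDl _ _) DS.
      by apply/forall_inP=> x; rewrite !inE => /andP[_ /uD].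
    apply/forall_inP=> x xX; apply/exists_inP.
    move: (no x); rewrite xX /=; have [dx|ndx] := boolP (T d x); last first.
      have /exists_inP[d' d'D d'x] := Dcov x xX; move=> _; exists d' => //.
      by rewrite !inE d'D andbT; apply: contraNneq ndx => <-.
    rewrite negb_forall => /existsP[d']; rewrite !negb_imply => /and3P[d'D nd nx].
    exists d'; first by rewrite !inE nd.
    apply: arcN nx; apply/eqP=> e; move/Xu: xX; rewrite e.
    exact: arc_asym (uD _ d'D).
  by move/setP/(_ d); rewrite !inE dD eqxx.
pose g d := odflt u [pick x | [&& x \in X, T d x &
                        [forall d' in D, (d' != d) ==> T x d']]].
have gP d : d \in D -> [&& g d \in X, T d (g d) &
                        [forall d' in D, (d' != d) ==> T (g d) d']].
  by move=> /privE[x xP]; rewrite /g; case: pickP => [//|/(_ x)]; rewrite xP.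
have [D' D'D cD'] : exists2 D' : {set V}, D' \subset D & #|D'| = k.+1.
  by apply: subset_of_card; lia.
have sD d : d \in D' -> d \in D by apply: subsetP.
apply: (@no_induced_matching u D' g) => //.
- exact: subset_trans D'D DS.
- by move=> d /sD/gP/and3P[gX _ _]; apply: (subsetP XS).
- by move=> d /sD dD; case/and3P: (gP d dD) => gX dg _; rewrite uD // Xu.
- move=> d d' /sD dD /sD d'D nd; case/and3P: (gP d dD) => _ _ /forall_inP/(_ _ d'D).
  by rewrite eq_sym nd.
Qed.

End Matching.

Lemma no_obstruction_second_in T k S X u : fvs_bounded T k.+1 S -> k <= 2 ->
  X \subset S -> obstruction T k X ->
  u \in S -> (forall x, x \in X -> T u x) ->
  (forall x, x \in X -> exists d, [/\ d \in S, T d u & T x d]) -> False.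
Proof.
move=> /fvs_bounded_converse bS k2 XS /obstruction_converse oX.
exact: (no_obstruction_second bS k2 XS oX).
Qed.

(** The out-neighbourhood of [x] is not contained in that of [v]: it is no smaller and misses [x]
    itself, which belongs to the latter. *)
Lemma card_minimal_out T (W : {set V}) v x :
  v \in W -> x \in W -> T v x ->
  #|[set y in W | T v y]| <= #|[set y in W | T x y]| ->
  exists d, [/\ d \in W, T d v & T x d].
Proof.
move=> vW xW vx le.
have : ~~ ([set y in W | T x y] \subset [set y in W | T v y]).
  apply/negP=> s; have /eqP/setP/(_ x) : [set y in W | T x y] == [set y in W | T v y].
    by rewrite eqEcard s.
  by rewrite !inE xW vx arc_irreflexive.
case/subsetPn=> d; rewrite !inE => /andP[dW xd]; rewrite dW /= => nvd.
exists d; split=> //; apply: arcN nvd.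
by apply: contraTneq xd => <-; apply/negP=> /(arc_asym vx).
Qed.

(** * Ordered sums *)

Lemma acyclicU T A B : acyclic T A -> acyclic T B ->
  (forall a b, a \in A -> b \in B -> T a b) -> acyclic T (A :|: B).
Proof.
move=> aA aB AB; apply/acyclicP=> x y z; rewrite !inE.
move=> /orP[xA|xB] /orP[yA|yB] /orP[zA|zB] xy yz.
- by move/acyclicP: aA => /(_ x y z); apply.
- exact: AB.
- by case: (arc_asym (AB _ _ zA yB) yz).
- exact: AB.
- by case: (arc_asym (AB _ _ yA xB) xy).
- by case: (arc_asym (AB _ _ yA xB) xy).
- by case: (arc_asym (AB _ _ zA yB) yz).
- by move/acyclicP: aB => /(_ x y z); apply.
Qed.

Lemma acyclic_small T A : #|A| <= 2 -> acyclic T A.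
Proof.
move=> cA; apply: acyclicI=> x y z xA yA zA xy yz zx.
have : #|[set x; y; z]| <= #|A|.
  by apply/subset_leq_card/subsetP=> t; rewrite !inE => /orP[/orP[]|] /eqP ->.
rewrite setUC cardsU1 cards2 !inE negb_or (arc_neq zx) (arc_neq xy).
by rewrite eq_sym (arc_neq yz) => /leq_trans/(_ cA).
Qed.

(** Any vertex [v] of [A] has two out-neighbours or two in-neighbours among three others, and they
    form a transitive triple with [v]. *)
Lemma acyclic_triple T A : 3 < #|A| ->
  exists Y, [/\ Y \subset A, #|Y| = 3 & acyclic T Y].
Proof.
move=> cA; have /card_gt0P[v vA] : 0 < #|A| by lia.
pose O := [set y in A | T v y]; pose I := [set y in A | T y v].
have cOI : 3 <= #|O| + #|I|.
  apply: leq_trans (leq_card_setU O I); move: cA; rewrite (cardsD1 v) vA add1n ltnS.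
  move/leq_trans; apply; apply/subset_leq_card/subsetP=> x; rewrite !inE.
  by move=> /andP[/(arc_orientation T) + ->]; case: (T x v); case: (T v x).
have : (2 <= #|O|) || (2 <= #|I|) by lia.
case/orP=> /subset_of_card[Y YO cY]; exists (v |: Y); split.
- by rewrite subUset sub1set vA; apply/subsetP=> y /(subsetP YO); rewrite inE => /andP[].
- rewrite cardsU1 cY; case vY: (v \in Y) => //.
  by move/(subsetP YO): vY; rewrite inE arc_irreflexive andbF.
- apply: acyclicU; [by apply: acyclic_small; rewrite cards1 | by apply: acyclic_small; rewrite cY |].
  by move=> a b; rewrite inE => /eqP -> /(subsetP YO); rewrite inE => /andP[].
- by rewrite subUset sub1set vA; apply/subsetP=> y /(subsetP YO); rewrite inE => /andP[].
- rewrite cardsU1 cY; case vY: (v \in Y) => //.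
  by move/(subsetP YO): vY; rewrite inE arc_irreflexive andbF.
- rewrite setUC; apply: acyclicU;
    [by apply: acyclic_small; rewrite cY | by apply: acyclic_small; rewrite cards1 |].
  by move=> a b /(subsetP YO) + /set1P->; rewrite inE => /andP[].
Qed.

(** Five vertices split between [A] and [B] as 5+0, 4+1 or 3+2. The last two give four acyclic
    vertices as 3+1 (a transitive triple and one vertex) and as 2+2. *)
Lemma fvs_boundedU2 T A B : fvs_bounded T 2 A -> fvs_bounded T 2 B ->
  (forall a b, a \in A -> b \in B -> T a b) -> fvs_bounded T 2 (A :|: B).
Proof.
move=> bA bB AB X XAB cX.
have glue A' B' m p : A' \subset A -> B' \subset B -> X = A' :|: B' ->
    (exists Y, [/\ Y \subset A', #|Y| = m & acyclic T Y]) ->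
    (exists Y, [/\ Y \subset B', #|Y| = p & acyclic T Y]) -> m + p = 4 ->
    exists Y, [/\ Y \subset X, #|Y| = 4 & acyclic T Y].
  move=> sA sB -> [Y [YA cY aY]] [Z [ZB cZ aZ]] mp; exists (Y :|: Z).
  have YZ a b : a \in Y -> b \in Z -> T a b.
    by move=> /(subsetP YA)/(subsetP sA) aA /(subsetP ZB)/(subsetP sB); apply: AB.
  split; [exact: setUSS | | exact: acyclicU].
  rewrite cardsU cY cZ mp; suff -> : Y :&: Z = set0 by rewrite cards0.
  apply/eqP/set0Pn=> -[x]; rewrite inE => /andP[xY xZ].
  by move: (YZ x x xY xZ); rewrite arc_irreflexive.
have small (C : {set V}) m : m <= 2 -> m <= #|C| -> exists Y, [/\ Y \subset C, #|Y| = m & acyclic T Y].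
  by move=> m2 /subset_of_card[Y YC cY]; exists Y; split=> //; apply: acyclic_small; lia.
pose A' := X :&: A; pose B' := X :\: A.
have XE : X = A' :|: B' by rewrite setID.
have sA : A' \subset A by apply: subsetIr.
have sB : B' \subset B.
  by apply/subsetP=> x; rewrite inE => /andP[xA /(subsetP XAB)]; rewrite inE (negbTE xA).
have cAB : #|A'| + #|B'| = 5 by rewrite -cX -(cardsID A X).
case cA' : #|A'| cAB => [|[|[|[|[|[|m]]]]]] cAB.
- apply: bB => //; suff -> : X = B' by [].
  by rewrite XE (cards0_eq cA') set0U.
- by apply: (glue A' B' 1 3) => //; [apply: small; rewrite ?cA' | apply: acyclic_triple; lia].
- by apply: (glue A' B' 2 2) => //; apply: small; lia.
- by apply: (glue A' B' 2 2) => //; apply: small; lia.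
- by apply: (glue A' B' 3 1) => //; [apply: acyclic_triple; lia | apply: small; lia].
- apply: bA => //; suff -> : X = A' by [].
  by have /cards0_eq B0 : #|B'| = 0 by [lia]; rewrite {1}XE B0 setU0.
- by lia.
Qed.

Lemma fvs_bounded_small T k A : #|A| <= k.*2 -> fvs_bounded T k A.
Proof. by move=> cA X /subset_leq_card/leq_trans/(_ cA); lia. Qed.

End Tournaments.

(** * Splitting into three parts with small local feedback vertex number *)

Section Labels.
Variables (V : finType) (T : tournament V).
Implicit Types (f : V -> nat) (x y z d u v w : V).

(* In all label functions the values 0 and 1 mean "not yet placed". *)
Definition spread f p q y :=
  if (f y <= 1) && [exists x, (f x == p) && T x y] then q else f y.

Definition relabel f (o : option V) q y := if Some y == o then q else f y.

(* Frontier vertices (label 1) are compared by in-degree, the others by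
   out-degree. *)
Definition degree f s x :=
  #|[set y | (f y == s) && (if s == 1 then T y x else T x y)]|.

Definition selected f s (o : option V) :=
  if o is Some v then f v = s /\ forall x, f x = s -> degree f s v <= degree f s x
  else forall x, f x != s.

Definition color_class f c := [set x | (1 < f x) && (f x %% 3 == c)].

(* Label 1 marks the frontier, 2 the pivots, 5 their out-neighbours, and j, which
   alternates between 3 and 4, the vertices at distance two from the pivot of the
   current round.  The part of a placed vertex is its label modulo 3. *)
Record split_invariant (j : nat) f := SplitInvariant {
  split_code : j = 3 \/ j = 4;
  split_arc : forall x y, f x <= 1 -> 1 < f y -> T y x -> f x = 1 /\ f y = 7 - j;
  split_frontier : forall x, f x = 1 ->
    exists d y, [/\ T d y, T y x & forall w, f w <= 1 -> T w d];
  split_class : forall c, c < 3 -> fvs_bounded T 2 (color_class f c) }.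

(** Each [spread] also starts from vertices that received the same label in earlier rounds;
    [split_arc] ensures that these have no arc to an unplaced vertex, so only the vertices of the
    current round count. *)
Definition split_step j f o :=
  spread (spread (spread (relabel f o 2) 2 5) 5 j) j 1.

(** Read as a number, this is the label among which the next pivot is selected. *)
Definition frontier f : nat := [exists x, f x == 1].

Lemma split_init : split_invariant 3 (fun=> 0).
Proof.
split=> //; first by left.
move=> c _; apply: fvs_bounded_small.
by rewrite (_ : color_class _ _ = set0) ?cards0 //; apply/setP=> x; rewrite !inE.
Qed.

Lemma selected_none f : selected f (frontier f) None -> forall x, 1 < f x.
Proof.
move=> + x; rewrite /frontier; case: existsP => [[y fy] /(_ y)|no] /=; first by rewrite fy.
move=> /(_ x); case fx: (f x) => [|[|m]] // _.
by case: no; exists x; rewrite fx.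
Qed.

(** The program always runs as many rounds as there are vertices, so the rounds after the last
    placement must change nothing. *)
Lemma split_step_idle j f : selected f (frontier f) None -> split_step j f None =1 f.
Proof.
move=> /selected_none f2; have spE g p q : (forall x, 1 < g x) -> spread g p q =1 g.
  by move=> g2 x; rewrite /spread leqNgt g2.
by move=> x; rewrite /split_step !spE // => y; rewrite !spE // => z; rewrite !spE.
Qed.

(** * One round of the splitting *)

Section SplitStep.
Variables (j : nat) (f : V -> nat).
Hypotheses (bT : fvs_bounded T 3 setT) (inv : split_invariant j f).

Lemma split_arc_code x y : f x <= 1 -> 1 < f y -> f y != 7 - j -> T x y.
Proof.
move=> fx fy nj; apply: arcN; first by apply: contraTneq fx => <-; rewrite -ltnNge.
by apply: contraNN nj => yx; have [_ ->] := split_arc inv fx fy yx.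
Qed.

Lemma split_step_none : selected f (frontier f) None ->
  split_invariant (7 - j) (split_step j f None).
Proof.
move=> sel; have f2 := selected_none sel; have E := split_step_idle j sel.
split; rewrite /color_class.
- by case: (split_code inv) => ->; [right | left].
- by move=> x y; rewrite E leqNgt f2.
- by move=> x; rewrite E => fx; move: (f2 x); rewrite fx.
- move=> c c3; suff -> : [set x | (1 < split_step j f None x) &&
      (split_step j f None x %% 3 == c)] = color_class f c by apply: split_class inv _ c3.
  by apply/setP=> x; rewrite !inE E.
Qed.

Variable v : V.
Hypothesis sel : selected f (frontier f) (Some v).

Let N := [set y | (f y <= 1) && T v y].
Let J := [set y | [&& f y <= 1, y != v, ~~ T v y & [exists x in N, T x y]]].
Let W := [set y | f y <= 1].

Let fv : f v <= 1.
Proof. by case: sel => -> _; rewrite /frontier; case: existsP. Qed.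

Let ltj : 2 < j < 5. Proof. by case: (split_code inv) => ->. Qed.

Let f1 := relabel f (Some v) 2.
Let f2 := spread f1 2 5.
Let f3 := spread f2 5 j.

Let f1E y : f1 y = if y == v then 2 else f y.
Proof. by rewrite /f1 /relabel (inj_eq (@Some_inj _)). Qed.

Let f2E y : f2 y = if y == v then 2 else if y \in N then 5 else f y.
Proof.
rewrite /f2 /spread f1E; case: (eqVneq y v) => [//|yv]; rewrite inE.
have [fy|//] := boolP (f y <= 1).
have -> // : [exists x, (f1 x == 2) && T x y] = T v y.
apply/existsP/idP=> [[x /andP[]]|vy]; last by exists v; rewrite f1E eqxx.
(* Another vertex of label 2 is an older pivot. Only label [7 - j], which is 3 or 4, may have arcs
   to unplaced vertices. *)
rewrite f1E; case: (eqVneq x v) => [->//|xv] /eqP fx xy.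
by have := split_arc inv fy _ xy; rewrite fx => /(_ isT) [_]; lia.
Qed.

Let f3E y : f3 y = if y \in J then j else f2 y.
Proof.
rewrite /f3 /spread f2E !inE; case: (eqVneq y v) => [->|yv] /=; first by rewrite andbF.
have [fy|//] := boolP (f y <= 1); last by move=> nfy; rewrite (negbTE nfy).
have [vy|vy] //= := boolP (T v y); rewrite fy /=.
congr (if _ then _ else _); apply/existsP/exists_inP=> [[x /andP[]]|[x xN xy]].
  rewrite f2E; case: (eqVneq x v) => [->//|xv]; case: ifP => [xN _ xy|_ /eqP fx xy].
    by exists x.
  by have := split_arc inv fy _ xy; rewrite fx => /(_ isT) [_]; lia.
exists x; rewrite f2E xN xy; case: (eqVneq x v) xN => // ->.
by rewrite inE arc_irreflexive andbF.
Qed.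

Let f4 := split_step j f (Some v).

(** The vertices that remain unplaced after the round. *)
Let R := [set y | [&& f y <= 1, y != v, y \notin N & y \notin J]].

Let f4E y : f4 y = if y \in R then (if [exists x in J, T x y] then 1 else f y) else f3 y.
Proof.
rewrite /f4 /split_step -/f1 -/f2 -/f3 /spread f3E.
have [yR|yR] := boolP (y \in R); last first.
  case: ifP => //= /andP[+ _]; case: ifP => yJ; first by lia.
  rewrite f2E; case: (eqVneq y v) => // yv; case: ifP => // yN fy.
  by move: yR; rewrite /R in_set fy yv yN yJ.
have /and4P[fy yv yN yJ] : [&& f y <= 1, y != v, y \notin N & y \notin J] by move: yR; rewrite /R in_set.
rewrite (negbTE yJ) f2E (negbTE yv) (negbTE yN) fy /=.
congr (if _ then _ else _); apply/existsP/exists_inP=> [[x /andP[]]|[x xJ xy]]; last first.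
  by exists x; rewrite f3E xJ eqxx.
rewrite f3E; case: ifP => [xJ _ xy|xJ]; first by exists x.
rewrite f2E; case: (eqVneq x v) => [_|xv]; first by move=> /eqP; lia.
case: ifP => [_|xN]; first by move=> /eqP; lia.
move=> /eqP fx xy; have fx2 : 1 < f x by rewrite fx; lia.
by have [_] := split_arc inv fy fx2 xy; lia.
Qed.


Let inR y : (y \in R) = [&& f y <= 1, y != v, y \notin N & y \notin J].
Proof. by rewrite /R in_set. Qed.

(* v is a king of the old frontier, by minimality of its in-degree there. *)
Let old_frontier y : f y = 1 -> y \notin R.
Proof.
move=> fy; rewrite inR; apply/negP=> /and4P[fy1 yv yN yJ].
have nvy : ~~ T v y by move: yN; rewrite inE fy1.
have Yv : T y v by apply: arcN nvy; rewrite eq_sym.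
have ny x : x \in N -> T y x.
  move=> xN; apply: arcN; first by apply: contraNneq yN => <-.
  by move: yJ; rewrite inE fy1 yv nvy /=; apply: contraNN => xy; apply/exists_inP; exists x.
have fr : frontier f = 1 by rewrite /frontier; case: existsP => // -[]; exists y; rewrite fy.
case: sel; rewrite fr => fv1 /(_ y fy); rewrite leqNgt => /negP; apply.
(* An in-neighbour of [y] on the frontier cannot lie in [N], so it dominates [v]; and [y] itself is
   one more in-neighbour of [v]. *)
rewrite /degree /=; apply: proper_card; apply/properP; split.
  apply/subsetP=> x; rewrite !inE => /andP[fx xy]; rewrite fx /=.
  have xv : x != v by apply: contraTneq xy => ->.
  apply: arcN; first by rewrite eq_sym.
  apply/negP=> vx; apply: (arc_asym xy); apply: ny; rewrite inE vx andbT.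
  by rewrite (eqP fx).
by exists y; rewrite !inE fy ?Yv ?arc_irreflexive.
Qed.

Let NW y : y \in N -> f y <= 1. Proof. by rewrite inE => /andP[]. Qed.
Let JW y : y \in J -> f y <= 1. Proof. by rewrite inE => /and4P[]. Qed.

(** A pivot from the frontier is the end of a path d -> y -> v whose start is dominated by all
    unplaced vertices. A starting pivot has minimum out-degree, so each of its out-neighbours
    returns to it in two steps. *)
Let N_bounded : fvs_bounded T 2 N.
Proof.
apply: fvs_boundedI=> X XN oX.
have vX x : x \in X -> T v x by move=> /(subsetP XN); rewrite inE => /andP[].
have XW x : x \in X -> f x <= 1 by move=> /(subsetP XN)/NW.
case: sel => fvE; rewrite /frontier in fvE *; case: existsP fvE => [_|no] fvE mind.
  have [d [y [dy yv Wd]]] := split_frontier inv fvE.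
  apply: (no_obstruction_path bT (subsetT X) oX _ _ _ dy yv) => // x /XW.
  exact: Wd.
have f01 x : (f x == 0) = (f x <= 1).
  by case fx: (f x) => [|[|m]] //; case: no; exists x; rewrite fx.
apply: (no_obstruction_second_in bT _ (subsetT X) oX (in_setT v)) => // x xX.
have vW : v \in W by rewrite inE.
have xW : x \in W by rewrite inE XW.
have le : #|[set y in W | T v y]| <= #|[set y in W | T x y]|.
  have degE z : degree f 0 z = #|[set y in W | T z y]|.
    by rewrite /degree; congr #|pred_of_set _|; apply/setP=> y; rewrite !inE f01.
  by rewrite -!degE; apply: mind; apply/eqP; rewrite f01 XW.
have [d [dW dv xd]] := card_minimal_out vW xW (vX x xX) le.
by exists d; rewrite inE.
Qed.

Let J_bounded : fvs_bounded T 2 J.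
Proof.
apply: fvs_boundedI=> X XJ oX.
apply: (no_obstruction_second bT _ (subsetT X) oX (in_setT v)) => // x /(subsetP XJ).
  by rewrite inE => /and4P[_ xv nvx _]; apply: arcN nvx; rewrite eq_sym.
rewrite inE => /and4P[_ _ _ /exists_inP[d dN dx]]; exists d; split=> //.
by move: dN; rewrite inE => /andP[].
Qed.

Let f4_old y : 1 < f y -> f4 y = f y.
Proof.
move=> fy; rewrite f4E inR leqNgt fy /= f3E.
case: ifP => [/JW|_]; first by rewrite leqNgt fy.
rewrite f2E; case: (eqVneq y v) => [yv|_]; first by move: fy; rewrite yv ltnNge fv.
by case: ifP => // /NW; rewrite leqNgt fy.
Qed.

Let vN : v \notin N. Proof. by rewrite inE arc_irreflexive andbF. Qed.
Let vJ : v \notin J. Proof. by rewrite inE eqxx andbF. Qed.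
Let NJ y : y \in N -> y \notin J.
Proof. by rewrite !inE => /andP[-> ->]; rewrite !andbF. Qed.

Let f4v : f4 v = 2.
Proof. by rewrite f4E inR eqxx andbF f3E (negbTE vJ) f2E eqxx. Qed.

Let f4N y : y \in N -> f4 y = 5.
Proof.
move=> yN; rewrite f4E inR yN !andbF f3E (negbTE (NJ yN)) f2E yN.
by case: eqVneq yN => // ->; rewrite (negbTE vN).
Qed.

Let f4J y : y \in J -> f4 y = j.
Proof. by move=> yJ; rewrite f4E inR yJ !andbF f3E yJ. Qed.

Let f4R y : y \in R -> f4 y <= 1 /\ (f4 y = 1 <-> exists2 x, x \in J & T x y).
Proof.
move=> yR; rewrite f4E yR; case: exists_inP => [ex|no]; first by split.
have fy : f y <= 1 by move: yR; rewrite inR => /and4P[].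
split=> //; split=> // fy1; by have := old_frontier fy1; rewrite yR.
Qed.

Let f4_le1 y : (f4 y <= 1) = (y \in R).
Proof.
apply/idP/idP=> [|/f4R[]//]; apply: contraTT; rewrite inR -ltnNge.
have [fy|fy] := leqP (f y) 1; last by rewrite f4_old.
have [->|yv] := eqVneq y v; first by rewrite f4v.
have [/f4N ->//|yN] := boolP (y \in N).
have [/f4J -> _|yJ] := boolP (y \in J); first by lia.
by [].
Qed.

Lemma split_step_some : split_invariant (7 - j) (split_step j f (Some v)).
Proof.
rewrite -/f4; split.
- by case: (split_code inv) => ->; [right | left].
- move=> x y; rewrite f4_le1 => xR f4y yx; rewrite subKn; last by lia.
  have [fx xv xN xJ] := and4P (etrans (esym (inR x)) xR).
  have [fy|fy] := leqP (f y) 1; last first.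
    have [fx1 _] := split_arc inv fx fy yx.
    by have := old_frontier fx1; rewrite xR.
  have [yv|yv] := eqVneq y v; first by move: xN; rewrite inE fx -yv yx.
  have [yN|yN] := boolP (y \in N).
    move: xJ; rewrite inE fx xv /=; case: (boolP (T v x)) => [vx|_] /=.
      by move: xN; rewrite inE fx vx.
    by case/negP; apply/exists_inP; exists y.
  have [yJ|yJ] := boolP (y \in J).
    by split; [apply/(proj2 (f4R xR)); exists y | apply: f4J].
  by move: f4y; rewrite ltnNge f4_le1 inR fy yv yN yJ.
- move=> x fx; have xR : x \in R by rewrite -f4_le1 fx.
  have [y yJ yx] := (proj1 (proj2 (f4R xR))) fx.
  move: (yJ); rewrite inE => /and4P[_ _ _ /exists_inP[d dN dy]].
  (* A remaining vertex dominated by [d], a member of [N], would have been put into [N] or [J]. *)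
  exists d, y; split=> // w; rewrite f4_le1 inR => /and4P[fw wv wN wJ].
  apply: arcN; first by apply: contraNneq wN => <-.
  apply: contraNN wJ => dw; rewrite inE fw wv /=; apply/andP; split.
    by move: wN; rewrite inE fw.
  by apply/exists_inP; exists d.
- move=> c c3; have cls := split_class inv c3.
  have old x y : f x <= 1 -> y \in color_class f c -> f y != 7 - j -> T x y.
    by move=> fx; rewrite inE => /andP[fy _]; apply: split_arc_code.
  have newE y : (y \in color_class f4 c) =
      (y \in color_class f c) || [|| (y == v) && (c == 2), (y \in N) && (c == 2)
                                   | (y \in J) && (c == j %% 3)].
    rewrite [y \in color_class f4 c]in_set [y \in color_class f c]in_set.
    have [fy|fy] := leqP (f y) 1; last first.
      rewrite f4_old // fy /=; have -> : (y \in N) = false by apply/negP=> /NW; lia.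
      have -> : (y \in J) = false by apply/negP=> /JW; lia.
      have -> : (y == v) = false by apply/negP=> /eqP e; move: fy; rewrite e; lia.
      by rewrite !orbF.
    have [->|yv] /= := eqVneq y v.
      by rewrite f4v (negbTE vN) (negbTE vJ) !orbF /= eq_sym.
    have [yN|yN] /= := boolP (y \in N).
      by rewrite f4N // (negbTE (NJ yN)) /= orbF eq_sym.
    have [yJ|yJ] /= := boolP (y \in J); first by rewrite f4J // eq_sym; lia.
    by rewrite ltnNge f4_le1 inR fy yv yN yJ.
  (* Part 2 grows by [v] and [N], which dominate all its earlier vertices: those have label 2 or 5,
     never [7 - j]. *)
  have [c2|c2] := eqVneq c 2.
    have -> : color_class f4 c = (v |: N) :|: color_class f c.
      apply/setP=> y; rewrite newE [y \in _ :|: _]in_setU in_setU1 c2 !andbT.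
      have -> : (2 == j %% 3) = false by case: (split_code inv) => ->.
      by rewrite andbF orbF orbC.
    apply: fvs_boundedU2 => //.
      apply: fvs_boundedU2 => //; first by apply: fvs_bounded_small; rewrite cards1.
      by move=> a b; rewrite in_set1 => /eqP -> ; rewrite inE => /andP[].
    move=> a b; rewrite in_setU1 => aW bc; apply: old => //.
      by case/orP: aW => [/eqP->//|/NW].
    move: bc; rewrite in_set c2 => /andP[_]; apply: contraTneq => ->.
    by case: (split_code inv) => ->.
  (* The part of [J] contains only older vertices of label [j]; the vertices of label [7 - j], which
     may dominate members of [J], are in the other part. *)
  have [cj|cj] := eqVneq c (j %% 3).
    have -> : color_class f4 c = J :|: color_class f c.
      apply/setP=> y; rewrite newE [y \in _ :|: _]in_setU -cj eqxx (negbTE c2).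
      by rewrite !andbF andbT /= orbC.
    apply: fvs_boundedU2 => // a b aJ bc; apply: old => //; first exact: JW.
    move: bc; rewrite in_set cj => /andP[_]; apply: contraTneq => ->.
    by case: (split_code inv) => ->.
  have -> : color_class f4 c = color_class f c; last by [].
  by apply/setP=> y; rewrite newE (negbTE c2) (negbTE cj) !andbF !orbF.
Qed.

Lemma split_step_progress : #|[set y | f4 y <= 1]| < #|[set y | f y <= 1]|.
Proof.
apply: proper_card; apply/properP; split.
  by apply/subsetP=> y; rewrite !in_set f4_le1 inR => /and4P[].
by exists v; rewrite in_set ?fv // f4v.
Qed.

End SplitStep.
End Labels.

(** * Layers of a part *)

Section Layers.
Variables (V : finType) (T : tournament V) (C : {set V}).
Hypothesis bC : fvs_bounded T 2 C.
Implicit Types (f B g : V -> nat) (x y z d u v w : V).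

Lemma cyclic_triangle (S : {set V}) x y z : x \in S -> y \in S -> z \in S ->
  T x y -> T y z -> T z x -> ~~ acyclic T S.
Proof. by move=> xS yS zS xy yz zx; apply/negP=> aS; exact: (acyclic_triangle aS xS yS zS xy yz zx). Qed.

Lemma cyclic_card3 x y z : ~~ acyclic T [set x; y; z] -> [/\ x != y, x != z & y != z].
Proof.
move=> nA; have : 2 < #|[set x; y; z]| by rewrite ltnNge; apply: contraNN nA; apply: acyclic_small.
rewrite setUC cardsU1 cards2 !inE [z == x]eq_sym [z == y]eq_sym.
by case: (x == y); case: (x == z); case: (y == z).
Qed.

(** Four of the five vertices are acyclic, so the fifth would meet all three triangles; but the
    triangles have no common vertex. *)
Lemma no_three_triangles a b c d e :
  a \in C -> b \in C -> c \in C -> d \in C -> e \in C ->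
  ~~ acyclic T [set a; b; c] -> ~~ acyclic T [set a; d; e] ->
  ~~ acyclic T [set b; d; e] -> c != d -> c != e -> False.
Proof.
move=> aC bC' cC dC eC t1 t2 t3 cd ce.
have [ab ac bc] := cyclic_card3 t1; have [ad ae de] := cyclic_card3 t2.
have [bd be _] := cyclic_card3 t3.
pose s := [:: a; b; c; d; e]; pose U := [set x in s].
have us : uniq s by rewrite /= !inE !negb_or ab ac ad ae bc bd be cd ce de.
have cU : #|U| = 5 by rewrite cardsE (card_uniqP us).
have [|Y [YU cY aY]] := bC (X := U) _ cU.
  by apply/subsetP=> x; rewrite !inE => /orP[|/orP[|/orP[|/orP[]]]] /eqP ->.
have /cards1P[v vE] : #|U :\: Y| == 1 by rewrite cardsD (setIidPr YU) cU cY.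
have hit (A : {set V}) : A \subset U -> ~~ acyclic T A -> v \in A.
  move=> AU; apply: contraNT => vA; apply: acyclicS aY; apply/subsetP=> x xA.
  apply: contraNT vA => xY; suff /set1P <- : x \in [set v] by [].
  by rewrite -vE inE xY (subsetP AU).
have h1 : v \in [set a; b; c].
  by apply: hit t1; apply/subsetP=> x; rewrite !inE => /orP[/orP[]|] ->; rewrite ?orbT.
have h2 : v \in [set a; d; e].
  by apply: hit t2; apply/subsetP=> x; rewrite !inE => /orP[/orP[]|] ->; rewrite ?orbT.
have h3 : v \in [set b; d; e].
  by apply: hit t3; apply/subsetP=> x; rewrite !inE => /orP[/orP[]|] ->; rewrite ?orbT.
move: h1 h2 h3; rewrite !inE => /orP[/orP[]|] /eqP -> => [_| |].
- by rewrite (negbTE ab) (negbTE ad) (negbTE ae).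
- by rewrite [b == a]eq_sym (negbTE ab) (negbTE bd) (negbTE be).
- by rewrite [c == a]eq_sym (negbTE ac) (negbTE cd) (negbTE ce).
Qed.

(* B x is the layer of x if 4 <= B x; label 2 marks the vertices outside C, and
   label 0 those not yet placed.  The last clause describes the top layer: it has
   no arc to the rest, or it is a fresh root of minimum out-degree, or it is
   dominated by a single vertex of the layer below. *)
Record layer_invariant t B := LayerInvariant {
  layer_out : forall x, (x \notin C) = (B x == 2);
  layer_code : forall x, [\/ B x = 0, B x = 2 | 4 <= B x < t];
  layer_arc : forall x y, B x = 0 -> 4 <= B y -> T y x -> (B y).+1 = t;
  layer_gap : forall x y, 4 <= B x -> B x + 2 <= B y -> T y x;
  layer_triangle : forall x y z, 4 <= B x -> 4 <= B y -> 4 <= B z ->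
    T x y -> T y z -> T z x -> B x <> B y;
  layer_top :
    [\/ forall x y, B x = 0 -> 4 <= B y -> T x y,
        exists u, (forall x, ((B x).+1 == t) = (x == u)) /\
          forall x, B x = 0 ->
            #|[set y | ((y == u) || (B y == 0)) && T u y]| <=
            #|[set y | ((y == u) || (B y == 0)) && T x y]|
      | exists q, [/\ 4 <= B q, (B q).+2 = t,
          forall y, (B y).+1 = t -> T q y &
          forall x y z, (B x).+1 = t -> (B y).+1 = t -> B z = 0 ->
            T x y -> T y z -> T z x -> False]] }.

(** An empty new layer means that the search from the current root is exhausted; [o] then supplies
    the next root. *)
Definition layer_step t B o :=
  let g := spread T B t.-1 t in
  if [exists x, g x == t] then g else relabel g o t.

(** * Adding one layer *)

Section LayerStep.
Variables (t : nat) (B : V -> nat) (o : option V).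
Hypotheses (t4 : 4 <= t) (inv : layer_invariant t B).
Let g := spread T B t.-1 t.

Let BC x : B x <> 2 -> x \in C.
Proof. by move=> b; apply/negPn; rewrite (layer_out inv); apply/eqP. Qed.

Let gE y : g y = if (B y == 0) && [exists x, ((B x).+1 == t) && T x y] then t else B y.
Proof.
rewrite /g /spread; have -> : (B y <= 1) = (B y == 0) by case: (layer_code inv y); lia.
congr (if _ then _ else _); congr (_ && _); apply: eq_existsb => x.
by congr (_ && _); lia.
Qed.

Let g_old y : B y != 0 -> g y = B y. Proof. by rewrite gE => /negbTE->. Qed.

Let g_top y : g y = t <-> B y = 0 /\ exists2 x, (B x).+1 = t & T x y.
Proof.
rewrite gE; case: ifP => [/andP[/eqP b0 /existsP[x /andP[/eqP bx xy]]]|no].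
  by split=> // _; split=> //; exists x.
split=> [bt|[b0 [x bx xy]]]; first by case: (layer_code inv y); lia.
by move/negP: no; case; rewrite b0 eqxx; apply/existsP; exists x; rewrite bx eqxx.
Qed.

Let g0 y : g y = 0 <-> B y = 0 /\ forall x, (B x).+1 = t -> T y x.
Proof.
rewrite gE; case: ifP => [/andP[/eqP b0 /existsP[x /andP[/eqP bx xy]]]|no].
  split; first by lia.
  by move=> [_ /(_ x bx)] /(arc_asym xy).
split=> [b0|[]//]; split=> // x bx; apply: arcN.
  by apply/eqP=> e; rewrite e in bx; lia.
by apply/negP=> xy; move/negP: no; case; rewrite b0 eqxx; apply/existsP; exists x; rewrite bx eqxx.
Qed.

Let W_arc x y : B x = 0 -> 4 <= B y -> (B y).+1 <> t -> T x y.
Proof.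
move=> bx by4 ne; apply: arcN; first by apply/eqP=> e; rewrite -e in bx; lia.
by apply/negP=> yx; apply: ne; apply: (layer_arc inv) yx.
Qed.

(** No arc leads from a placed vertex to an unplaced one, so the new root dominates all layers below
    and lies on no triangle with them. *)
Lemma layer_step_restart : ~~ [exists x, g x == t] -> selected T g 0 o ->
  layer_invariant t.+1 (relabel g o t).
Proof.
move=> /existsPn no; have gB y : g y = B y.
  by move: (no y); rewrite gE; case: ifP => //; rewrite eqxx.
have W_all x y : B x = 0 -> 4 <= B y -> T x y.
  move=> bx by4; have [bt|/eqP] := eqVneq (B y).+1 t; last exact: W_arc.
  by have [_] := proj1 (g0 x) (etrans (gB x) bx); apply.
case: o => [u [gu umin]|noW]; last first.
  have hE y : relabel g None t y = B y by rewrite /relabel /= gB.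
  have nW x : B x <> 0 by move: (noW x); rewrite gB => /eqP.
  split.
  - by move=> x; rewrite hE (layer_out inv).
  - move=> x; rewrite hE; case: (layer_code inv x) => ?;
      [constructor 1 | constructor 2 | constructor 3; lia] => //.
  - by move=> x y; rewrite hE => /nW.
  - by move=> x y; rewrite !hE; apply: (layer_gap inv).
  - by move=> x y z; rewrite !hE; apply: (layer_triangle inv).
  - by constructor 1=> x y; rewrite hE => /nW.
have bu : B u = 0 by rewrite -gB.
have hE y : relabel g (Some u) t y = if y == u then t else B y.
  by rewrite /relabel (inj_eq (@Some_inj _)) gB.
have lvl x : 4 <= B x -> B x < t by case: (layer_code inv x); lia.
have nu x : 4 <= B x -> x != u by move=> bx; apply/eqP=> e; rewrite e in bx; lia.
have uout x y : 4 <= (if x == u then t else B x) -> T x y -> y != u.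
  case: (eqVneq x u) => [->|xu] bx xy; first by rewrite eq_sym (arc_neq xy).
  apply/eqP=> e; rewrite e in xy; exact: arc_asym xy (W_all u x bu bx).
split.
- by move=> x; rewrite hE (layer_out inv); case: (eqVneq x u) => // ->; rewrite bu; lia.
- move=> x; rewrite hE; case: (eqVneq x u) => [_|_]; first by constructor 3; lia.
  case: (layer_code inv x) => ?;
      [constructor 1 | constructor 2 | constructor 3; lia] => //.
- move=> x y; rewrite !hE; case: (eqVneq x u) => [_|xu bx]; first by lia.
  case: (eqVneq y u) => // yu by4 yx; case: (arc_asym yx (W_all x y bx by4)).
- move=> x y; rewrite !hE; case: (eqVneq y u) => [->|yu].
    by case: (eqVneq x u) => [_|xu bx _]; [lia | apply: W_all].
  case: (eqVneq x u) => [_ _|xu]; last exact: (layer_gap inv).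
  by case: (leqP 4 (B y)) => [/lvl|]; lia.
- move=> x y z; rewrite !hE => bx by4 bz xy yz zx.
  have yu := uout x y bx xy; have zu := uout y z by4 yz; have xu := uout z x bz zx.
  move: bx by4 bz; rewrite (negbTE xu) (negbTE yu) (negbTE zu) => bx by4 bz.
  exact: (layer_triangle inv bx by4 bz xy yz zx).
- constructor 2; exists u; split=> [x|x].
    rewrite hE; case: (eqVneq x u) => [_|xu]; first by rewrite eqxx.
    by case: (layer_code inv x); lia.
  rewrite hE; case: (eqVneq x u) => [_|xu bx]; first by lia.
  have setE v : [set y | ((y == u) || (relabel g (Some u) t y == 0)) && T v y] =
                [set y | (g y == 0) && T v y].
    apply/setP=> y; rewrite !inE hE gB; case: (eqVneq y u) => [->|//].
    by rewrite bu.
  by rewrite !setE; have := umin x; rewrite /degree /= gB; apply.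
Qed.

(** The heart of the matter is that a single vertex of the old top layer dominates the new layer. It
    becomes the [q] of the next [layer_top]. *)
Lemma layer_step_next : [exists x, g x == t] -> layer_invariant t.+1 g.
Proof.
case/existsP=> z0 /eqP gz0.
have level x : 4 <= g x -> [\/ B x = 0 /\ g x = t | g x = B x /\ 4 <= B x < t].
  case: (eqVneq (B x) 0) => [b0|/g_old->]; last by right; case: (layer_code inv x); lia.
  by rewrite gE b0; case: ifP => // _ _; left.
(* These are the triangles with two vertices in one layer that placing the new layer could create;
   the remaining ones are excluded by [W_arc] or by the old invariant. *)
have topN :
  (forall x y z, g x = t -> g y = t -> g z = t -> T x y -> T y z -> T z x -> False) /\
  (forall x y z, g x = t -> g y = t -> (B z).+1 = t -> T x y -> T y z -> T z x -> False) /\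
  (forall x y z, (B x).+1 = t -> (B y).+1 = t -> B z = 0 -> T x y -> T y z -> T z x -> False) /\
  exists q, [/\ 4 <= B q, (B q).+1 = t, forall y, g y = t -> T q y &
          forall x y z, g x = t -> g y = t -> g z = 0 ->
            T x y -> T y z -> T z x -> False].
  have LC y : g y = t -> y \in C by move=> /g_top[b0 _]; apply: BC; rewrite b0.
  have [x0 bx0 xz0] := proj2 (proj1 (g_top z0) gz0).
  have lev4 x : (B x).+1 = t -> 4 <= B x by case: (layer_code inv x); lia.
  have L0 y : g y = t -> B y = 0 by case/g_top.
  case: (layer_top inv) => [noarc|[u [uE umin]]|[q [bq qt qdom noB]]].
  - case: (arc_asym xz0); apply: noarc; [exact: L0 | exact: lev4].
  - have but : (B u).+1 = t by apply/eqP; rewrite uE.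
    have uC : u \in C by apply: BC; have := lev4 u but; lia.
    have uL y : g y = t -> T u y.
      by case/g_top=> _ [x /eqP]; rewrite uE => /eqP ->.
    (* By minimality of its out-degree, the root is reached in two steps from each of its
       out-neighbours, through an unplaced vertex. *)
    have back y : g y = t -> exists d, [/\ B d = 0, T d u & T y d].
      move=> gy; pose W := [set y | (y == u) || (B y == 0)].
      have [|||d [dW du yd]] := @card_minimal_out _ T W u y _ _ (uL y gy).
      - by rewrite inE eqxx.
      - by rewrite inE L0 // eqxx orbT.
      - have WE v : [set y in W | T v y] = [set y | ((y == u) || (B y == 0)) && T v y].
          by apply/setP=> w; rewrite !inE.
        by rewrite !WE; apply: umin; apply: L0.
      exists d; split=> //; move: dW; rewrite inE (negbTE (arc_neq du)) /=.
      by move/eqP.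
    have aL : acyclic T [set y | g y == t].
      apply: fvs_bounded1; apply: fvs_boundedI=> X XL oX.
      have XC : X \subset C by apply/subsetP=> x /(subsetP XL); rewrite inE => /eqP/LC.
      apply: (no_obstruction_second_in bC _ XC oX uC) => // x /(subsetP XL);
        rewrite inE => /eqP gx; first exact: uL.
      by have [d [bd du xd]] := back x gx; exists d; rewrite BC ?bd.
    split.
      by move=> x y z gx gy gz; apply: (acyclic_triangle aL); rewrite inE ?gx ?gy ?gz.
    split; first move=> x y z gx gy /eqP; first rewrite uE => /eqP -> xy yu.
      by case: (arc_asym yu (uL y gy)).
    split; first move=> x y z /eqP; first rewrite uE => /eqP -> /eqP.
      by rewrite uE => /eqP -> _; rewrite arc_irreflexive.
    exists u; split=> //; first exact: lev4.
    move=> x y z gx gy /g0[bz Wz] xy yz zx.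
    have [d [bd du xd]] := back x gx; have zu := Wz u but.
    have [ux uy] := (uL x gx, uL y gy).
    (* The triangles on u x d, u y z and x y z have no common vertex. *)
    apply: (@no_three_triangles u x d y z) => //.
    + exact: LC.
    + by apply: BC; rewrite bd.
    + exact: LC.
    + by apply: BC; rewrite bz.
    + by apply: (cyclic_triangle _ _ _ ux xd du); rewrite !inE eqxx ?orbT.
    + by apply: (cyclic_triangle _ _ _ uy yz zu); rewrite !inE eqxx ?orbT.
    + by apply: (cyclic_triangle _ _ _ xy yz zx); rewrite !inE eqxx ?orbT.
    + by apply/eqP=> e; rewrite e in du; apply: arc_asym du uy.
    + by apply/eqP=> e; rewrite e in xd; apply: arc_asym xd zx.
  - have qC : q \in C by apply: BC; lia.
    have topC x : (B x).+1 = t -> x \in C by move=> bx; apply: BC; lia.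
    have Wq y : B y = 0 -> T y q by move=> b0; apply: W_arc => //; lia.
    pose out p := [set y | (g y == t) && T p y].
    (* A vertex of the old top layer with the most out-neighbours in the new layer works: if it
       missed [y], another vertex dominating [y] would miss one of its out-neighbours [y']. *)
    have [p bp pdom] : exists2 p, (B p).+1 = t & forall y, g y = t -> T p y.
      have Px0 : (B x0).+1 == t by apply/eqP.
      case: (@arg_maxnP _ x0 (fun p => (B p).+1 == t) (fun p => #|out p|) Px0).
      move=> p /eqP bp pmax; exists p => // y gy.
      apply: contraT => npy.
      have [by0 [p' bp' p'y]] := proj1 (g_top y) gy.
      have yp : T y p by apply: arcN npy; apply/eqP=> e; rewrite e in bp; lia.
      have : ~~ (out p \subset out p').
        apply/negP=> s; have le := pmax p' (introT eqP bp').
        have /eqP/setP/(_ y) : out p == out p' by rewrite eqEcard s.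
        by rewrite !inE gy eqxx (negbTE npy) p'y.
      case/subsetPn=> y'; rewrite !inE => /andP[/eqP gy' py']; rewrite gy' eqxx /= => np'y'.
      have y'p' : T y' p'.
        by apply: arcN np'y'; apply/eqP=> e; have := L0 y' gy'; rewrite -e; lia.
      have pp' : p' != p by apply/eqP=> e; rewrite -e p'y in npy.
      (* Since [q] dominates [p] and [p'] and is dominated by [y] and [y'], the arcs p -> y' and p'
         -> y form an induced matching for [q]. *)
      exfalso; apply: (@no_induced_matching _ T 1 C bC q [set p; p']
                 (fun d => if d == p then y' else y)) => //.
      + by apply/subsetP=> d; rewrite !inE => /orP[]/eqP->; apply: topC.
      + by move=> d _; case: ifP => _; apply: LC.
      + by rewrite cards2 eq_sym pp'.
      + move=> d; rewrite !inE => /orP[]/eqP->; rewrite ?eqxx ?(negbTE pp').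
          by split=> //; [apply: qdom | apply: Wq; apply: L0].
        by split=> //; [apply: qdom | apply: Wq].
      + move=> d d'; rewrite !inE => /orP[]/eqP-> /orP[]/eqP->; rewrite ?eqxx ?(negbTE pp') //.
    have pC := topC p bp; have qp := qdom p bp.
    have aL : acyclic T [set y | g y == t].
      apply: fvs_bounded1; apply: fvs_boundedI=> X XL oX.
      have XC : X \subset C by apply/subsetP=> x /(subsetP XL); rewrite inE => /eqP/LC.
      apply: (no_obstruction_arc bC XC oX qC pC qp) => x /(subsetP XL);
        rewrite inE => /eqP gx; [exact: Wq (L0 x gx) | exact: pdom].
    split.
      by move=> x y z gx gy gz; apply: (acyclic_triangle aL); rewrite inE ?gx ?gy ?gz.
    split.
      move=> x y z gx gy bz xy yz zx.
      have [qz xq] := (qdom z bz, Wq x (L0 x gx)).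
      have [py yq] := (pdom y gy, Wq y (L0 y gy)).
      apply: (@no_three_triangles q y p z x) => //.
      + exact: LC.
      + exact: topC.
      + exact: LC.
      + by apply: (cyclic_triangle _ _ _ qp py yq); rewrite !inE eqxx ?orbT.
      + by apply: (cyclic_triangle _ _ _ qz zx xq); rewrite !inE eqxx ?orbT.
      + by apply: (cyclic_triangle _ _ _ xy yz zx); rewrite !inE eqxx ?orbT.
      + by apply/eqP=> e; rewrite e in py; apply: arc_asym py yz.
      + by apply/eqP=> e; have := L0 x gx; rewrite -e; lia.
    split; first exact: noB.
    exists p; split=> //; first exact: lev4.
    move=> x y z gx gy /g0[bz Wz] xy yz zx.
    have [px xq] := (pdom x gx, Wq x (L0 x gx)).
    have [py zp] := (pdom y gy, Wz p bp).
    apply: (@no_three_triangles p x q y z) => //.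
    + exact: LC.
    + exact: LC.
    + by apply: BC; rewrite bz.
    + by apply: (cyclic_triangle _ _ _ qp px xq); rewrite !inE eqxx ?orbT.
    + by apply: (cyclic_triangle _ _ _ py yz zp); rewrite !inE eqxx ?orbT.
    + by apply: (cyclic_triangle _ _ _ xy yz zx); rewrite !inE eqxx ?orbT.
    + by apply/eqP=> e; have := L0 y gy; rewrite -e; lia.
    + by apply/eqP=> e; rewrite -e in bz; lia.
have [no3 [no2 [no1 [q [bq qt qdom qno]]]]] := topN.
split.
- move=> x; rewrite (layer_out inv); case: (eqVneq (B x) 0) => [b0|/g_old->//].
  by rewrite gE b0; case: ifP => // _; lia.
- move=> x; case: (leqP 4 (g x)) => [/level[[_ ->]|[-> ?]]|].
  + by constructor 3; lia.
  + by constructor 3; lia.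
  rewrite gE; case: ifP => [_|_]; first by lia.
  by case: (layer_code inv x) => ?; [constructor 1 | constructor 2 | constructor 3; lia].
- move=> x y /g0[bx Wx] /level[[by0 ->//]|[-> by4]] yx.
  have e := layer_arc inv bx (proj1 (andP by4)) yx.
  by case: (arc_asym yx (Wx y e)).
- move=> x y /level[[bx ->]|[-> bx]] /= le.
    by case: (level y); lia.
  have gy4 : 4 <= g y by lia.
  have [[by0 gy]|[gy by4]] := level y gy4; first by apply: W_arc => //; lia.
  by apply: (layer_gap inv); lia.
- move=> x y z gx gy gz xy yz zx e.
  have [[bx0 gxt]|[gxE bx]] := level x gx.
    have gyt : g y = t by rewrite -e.
    have by0 := proj1 (proj1 (g_top y) gyt).
    have [[bz0 gzt]|[gzE bz]] := level z gz; first exact: (no3 x y z).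
    have [bzt|bzt] := eqVneq (B z).+1 t; first exact: (no2 x y z).
    apply: (arc_asym zx); apply: W_arc => //; first by lia.
    exact/eqP.
  have [[by0 gyt]|[gyE by4]] := level y gy; first by lia.
  have [[bz0 gzt]|[gzE bz]] := level z gz.
    have [bxt|bxt] := eqVneq (B x).+1 t; first by apply: (no1 x y z) => //; lia.
    apply: (arc_asym yz); apply: W_arc => //; first by lia.
    by apply/eqP; rewrite -gyE -e gxE.
  apply: (layer_triangle inv _ _ _ xy yz zx); lia.
- constructor 3; exists q; have gq : g q = B q by rewrite g_old //; lia.
  split; rewrite ?gq //; first by lia.
  + by move=> y [/qdom].
  + by move=> x y z [gx] [gy]; apply: qno.
Qed.

Lemma layer_step_invariant : selected T g 0 o ->
  layer_invariant t.+1 (layer_step t B o).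
Proof.
rewrite /layer_step -/g; case: ifP => [ex _|/negbT no]; first exact: layer_step_next.
exact: layer_step_restart.
Qed.

End LayerStep.

(** Layers are numbered from 4 because the first round spreads from label 3, which no vertex
    carries. This makes it place a root; starting at 3 would spread from the vertices outside
    [C]. *)
Lemma layer_init : layer_invariant 4 (fun x => if x \in C then 0 else 2).
Proof.
split=> [x|x|x y _|x y|x y z|].
- by case: ifP.
- by case: ifP => _; [constructor 1 | constructor 2].
- by case: ifP.
- by case: ifP.
- by case: ifP.
- by constructor 1=> x y _; case: ifP.
Qed.

(** By [layer_gap] an arc climbs at most one layer, and a triangle has its vertices in three
    distinct layers. These layers are therefore consecutive, and one of them is in the deleted
    class. *)
Lemma layer_acyclic t B r : layer_invariant t B -> (forall x, B x != 0) ->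
  r < 3 -> acyclic T [set x in C | B x %% 3 != r].
Proof.
move=> inv n0 r3; have B4 x : x \in C -> 4 <= B x.
  move=> xC; case: (layer_code inv x) => [b0|b2|/andP[]//].
    by move: (n0 x); rewrite b0.
  by move: (layer_out inv x); rewrite b2 xC.
have step x y : x \in C -> y \in C -> T x y -> B y <= (B x).+1.
  move=> xC yC xy; rewrite leqNgt; apply/negP=> lt.
  by apply: (arc_asym xy); apply: (layer_gap inv); rewrite ?B4 // addn2.
apply: acyclicI=> x y z; rewrite !inE => /andP[xC xr] /andP[yC yr] /andP[zC zr] xy yz zx.
have [bx by4 bz] := And3 (B4 x xC) (B4 y yC) (B4 z zC).
have := layer_triangle inv bx by4 bz xy yz zx.
have := layer_triangle inv by4 bz bx yz zx xy.
have := layer_triangle inv bz bx by4 zx xy yz.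
move: (step x y xC yC xy) (step y z yC zC yz) (step z x zC xC zx) => s1 s2 s3 n1 n2 n3.
by lia.
Qed.

End Layers.

(** * Structured programs with bounded loops *)

Lemma bits_le n k : n < 2 ^ k -> bits n <= k.
Proof. exact: up_log_min. Qed.

Lemma ltn_bits n : n < 2 ^ bits n.
Proof. exact: up_logP. Qed.

Inductive prog :=
  | PSkip
  | PSet of nat & expr & expr
  | PSeq of prog & prog
  | PIf of expr & prog & prog
  | PFor of nat & expr & prog.

Definition scalar k := Get k (Const 0).

Definition for_guard k e := Bin Leq (Bin Add (scalar k) (Const 1)) e.

Definition for_next k := Bin Add (scalar k) (Const 1).

Fixpoint compile (p : prog) : cmd :=
  match p with
  | PSkip => Skip
  | PSet a i e => Set_ a i e
  | PSeq p q => Seq (compile p) (compile q)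
  | PIf e p q => If e (compile p) (compile q)
  | PFor k e p =>
      Seq (Set_ k (Const 0) (Const 0))
          (While (for_guard k e) (Seq (compile p) (Set_ k (Const 0) (for_next k))))
  end.

Fixpoint writes (p : prog) : seq nat :=
  match p with
  | PSkip => [::]
  | PSet a _ _ => [:: a]
  | PSeq p q | PIf _ p q => writes p ++ writes q
  | PFor k _ p => k :: writes p
  end.

(* Constants are charged their value, so that [eval m e < 2 ^ (b * expr_size e)]
   needs no bound on the constants of the program. *)
Fixpoint expr_size (e : expr) : nat :=
  match e with
  | Const n => n.+1
  | Get _ i => (expr_size i).+1
  | Bin _ e1 e2 => (expr_size e1 + expr_size e2).+1
  end.

(** There are at most [expr_size e] nodes, and the value of each has length at most
    [b * expr_size e]. *)
Definition expr_bound b e := expr_size e * (b * expr_size e).+1.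

(** Here [n] bounds the iterations of every loop. Both branches of a conditional are charged, so
    that only sums and products occur and the bound is visibly polynomial in [b] and [n]. *)
Fixpoint cost (b n : nat) (p : prog) : nat :=
  match p with
  | PSkip => 1
  | PSet _ i e => (expr_bound b i + expr_bound b e).+1
  | PSeq p q => (cost b n p + cost b n q).+1
  | PIf e p q => (expr_bound b e + (cost b n p + cost b n q)).+1
  | PFor k e p =>
      ((expr_bound b (Const 0) + expr_bound b (Const 0)).+1 +
       (n * (expr_bound b (for_guard k e) +
             (cost b n p + (expr_bound b (Const 0) + expr_bound b (for_next k)).+1).+1).+1
        + (expr_bound b (for_guard k e)).+1)).+1
  end.

Definition bounded b (m : memory) := forall a i, m a i < 2 ^ b.

(** Lengths at most add up under the operations, apart from one carry bit, which the operation's own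
    node pays for. *)
Lemma eval_lt b m e : 0 < b -> bounded b m -> eval m e < 2 ^ (b * expr_size e).
Proof.
move=> b0 bm; elim: e => [n|a i IH|o e1 IH1 e2 IH2] /=.
- apply: leq_trans (@ltn_expl 2 n isT) _.
  by rewrite leq_exp2l // mulnS (leq_trans _ (leq_addl _ _)) // leq_pmull.
- by apply: leq_trans (bm _ _) _; rewrite leq_exp2l // leq_pmulr.
set x := eval m e1 in IH1 *; set y := eval m e2 in IH2 *.
set p := b * expr_size e1 in IH1 *; set q := b * expr_size e2 in IH2 *.
have -> : b * (expr_size e1 + expr_size e2).+1 = b + (p + q) by rewrite /p /q; lia.
have pw : 2 ^ (p + q).+1 <= 2 ^ (b + (p + q)) by rewrite leq_exp2l //; lia.
have px : 2 ^ p <= 2 ^ (p + q) by rewrite leq_exp2l // leq_addr.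
have py : 2 ^ q <= 2 ^ (p + q) by rewrite leq_exp2l // leq_addl.
have gt0 : 0 < 2 ^ (p + q) by rewrite expn_gt0.
rewrite expnS in pw.
case: o => /=.
- by lia.
- by have := leq_subr y x; lia.
- have : x * y < 2 ^ p * 2 ^ q by apply: ltn_mul.
  by rewrite -expnD; lia.
- by have := leq_div x y; lia.
- by case: (x <= y) => /=; lia.
- by case: (x == y) => /=; lia.
Qed.

Lemma expr_cost_le b m e : 0 < b -> bounded b m -> expr_cost m e <= expr_bound b e.
Proof.
move=> b0 bm; have bt e' : bits (eval m e') <= b * expr_size e'.
  by apply: bits_le; apply: eval_lt.
rewrite /expr_bound; elim: e => [n|a i IH|o e1 IH1 e2 IH2].
- by have := bt (Const n) => /=; nia.
- have := bt (Get a i) => /=; move: IH => /=; set c := expr_cost m i.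
  set s := expr_size i => IH; set v := bits _ => le.
  by nia.
- have := bt (Bin o e1 e2) => /=; move: IH1 IH2 => /=.
  set c1 := expr_cost m e1; set c2 := expr_cost m e2.
  set s1 := expr_size e1; set s2 := expr_size e2 => IH1 IH2; set v := bits _ => le.
  by nia.
Qed.

(** * Proof rules for total correctness, cost and frame *)

Section WeakestPrecondition.
Variables (b n : nat).
Hypothesis b0 : 0 < b.

(** Termination, cost, size of values and frame share one predicate: each rule settles them
    together, and [Q] speaks only of the values computed. *)
Definition wp p m (Q : memory -> Prop) := bounded b m ->
  exists m' t, [/\ exec (compile p) m m' t, t <= cost b n p, bounded b m',
    forall a i : nat, a \notin writes p -> m' a i = m a i & Q m'].

Lemma wp_conseq p m (Q Q' : memory -> Prop) : wp p m Q ->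
  (forall m', bounded b m' -> (forall a i : nat, a \notin writes p -> m' a i = m a i) ->
     Q m' -> Q' m') -> wp p m Q'.
Proof.
move=> wpQ QQ' /wpQ[m' [t [ex le bm' fr q]]]; exists m', t; split=> //.
exact: QQ'.
Qed.

Lemma wp_skip m (Q : memory -> Prop) : Q m -> wp PSkip m Q.
Proof. by move=> q bm; exists m, 1; split=> //; constructor. Qed.

Lemma bounded_update m a i v : bounded b m -> v < 2 ^ b -> bounded b (update m a i v).
Proof. by move=> bm lt c j; rewrite /update; case: ifP. Qed.

Lemma wp_set a i e m (Q : memory -> Prop) : eval m e < 2 ^ b ->
  Q (update m a (eval m i) (eval m e)) -> wp (PSet a i e) m Q.
Proof.
move=> lt q bm; exists (update m a (eval m i) (eval m e)), (expr_cost m i + expr_cost m e).+1.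
split=> //; first exact: ExecSet.
- by rewrite /= ltnS leq_add // expr_cost_le.
- exact: bounded_update.
- by move=> c j; rewrite /= inE /update => /negbTE ->.
Qed.

Lemma wp_seq p q m (Q : memory -> Prop) : wp p m (fun m' => wp q m' Q) -> wp (PSeq p q) m Q.
Proof.
move=> wpp /wpp[m1 [t1 [ex1 le1 bm1 fr1 wpq]]].
have [m2 [t2 [ex2 le2 bm2 fr2 q2]]] := wpq bm1.
exists m2, (t1 + t2).+1; split=> //; first exact: ExecSeq ex1 ex2.
- by rewrite /= ltnS leq_add.
- by move=> a i; rewrite /= mem_cat negb_or => /andP[a1 a2]; rewrite fr2 ?fr1.
Qed.

Lemma wp_if e p q m (Q : memory -> Prop) :
  (eval m e != 0 -> wp p m Q) -> (eval m e = 0 -> wp q m Q) -> wp (PIf e p q) m Q.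
Proof.
move=> wp1 wp2 bm; have ce := expr_cost_le e b0 bm.
have [e0|e0] := eqVneq (eval m e) 0.
  have [m' [t [ex le bm' fr q']]] := wp2 e0 bm.
  exists m', (expr_cost m e + t).+1; split=> //; first exact: ExecIfFalse.
  - by rewrite /=; lia.
  - by move=> a i; rewrite /= mem_cat negb_or => /andP[_]; apply: fr.
have [m' [t [ex le bm' fr q']]] := wp1 e0 bm.
exists m', (expr_cost m e + t).+1; split=> //; first exact: ExecIfTrue.
- by rewrite /=; lia.
- by move=> a i; rewrite /= mem_cat negb_or => /andP[+ _]; apply: fr.
Qed.

(** The loop bound may be any expression whose value is independent of the arrays that the loop
    writes. The proof is by induction on the number [d] of iterations left. *)
Lemma wp_for k e p m M (I : nat -> memory -> Prop) :
  k \notin writes p -> M <= n -> M < 2 ^ b ->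
  (forall m' : memory, (forall a i : nat, a \notin k :: writes p -> m' a i = m a i) -> eval m' e = M) ->
  I 0 (update m k 0 0) ->
  (forall j m', j < M -> m' k 0 = j ->
     (forall a i : nat, a \notin k :: writes p -> m' a i = m a i) -> I j m' ->
     wp p m' (fun m'' => I j.+1 (update m'' k 0 j.+1))) ->
  wp (PFor k e p) m (I M).
Proof.
move=> kp Mn Mb eM I0 step bm.
pose body := (expr_bound b (for_guard k e) +
  (cost b n p + (expr_bound b (Const 0) + expr_bound b (for_next k)).+1).+1).+1.
suff loop d j m1 : d + j = M -> m1 k 0 = j -> bounded b m1 ->
    (forall a i : nat, a \notin k :: writes p -> m1 a i = m a i) -> I j m1 ->
    exists m' t, [/\ exec (While (for_guard k e)
        (Seq (compile p) (Set_ k (Const 0) (for_next k)))) m1 m' t,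
      t <= d * body + (expr_bound b (for_guard k e)).+1, bounded b m',
      forall a i : nat, a \notin k :: writes p -> m' a i = m a i & I M m'].
  have bm0 : bounded b (update m k 0 0) by apply: bounded_update; rewrite ?expn_gt0.
  have fr0 a i : a \notin k :: writes p -> update m k 0 0 a i = m a i.
    by rewrite inE negb_or /update => /andP[/negbTE ->].
  have k0 : update m k 0 0 k 0 = 0 by rewrite /update !eqxx.
  have [m' [t [ex le bm' fr q]]] := loop M 0 _ (addn0 _) k0 bm0 fr0 I0.
  exists m', ((expr_cost m (Const 0) + expr_cost m (Const 0)).+1 + t).+1; split=> //.
    by apply: ExecSeq ex; apply: ExecSet.
  rewrite /= -/body ltnS leq_add //.
    by rewrite ltnS leq_add // (expr_cost_le (Const 0) b0 bm).
  by apply: leq_trans le _; rewrite leq_add2r leq_mul2r Mn orbT.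
elim: d j m1 => [|d IHd] j m1 dj kj bm1 fr1 Ij.
  have g0 : eval m1 (for_guard k e) = 0 by rewrite /= kj (eM _ fr1); lia.
  exists m1, (expr_cost m1 (for_guard k e)).+1; split=> //.
  - exact: ExecWhileFalse.
  - by rewrite mul0n ltnS expr_cost_le.
  - by rewrite -dj.
have g1 : eval m1 (for_guard k e) != 0 by rewrite /= kj (eM _ fr1); lia.
have jM : j < M by lia.
have [m2 [t2 [ex2 le2 bm2 fr2 I2]]] := step j m1 jM kj fr1 Ij bm1.
have kj2 : m2 k 0 = j by rewrite fr2.
have nx : eval m2 (for_next k) = j.+1 by rewrite /= kj2 addn1.
have bm3 : bounded b (update m2 k 0 j.+1).
  by apply: bounded_update => //; lia.
have [|||||m' [t [ex le bm' fr q]]] := IHd j.+1 (update m2 k 0 j.+1).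
- by lia.
- by rewrite /update !eqxx.
- by [].
- move=> a i; rewrite inE negb_or => /andP[ak ap]; rewrite /update (negbTE ak) /=.
  by rewrite fr2 // fr1 // inE negb_or ak.
- by [].
exists m', (expr_cost m1 (for_guard k e) +
   (t2 + (expr_cost m2 (Const 0) + expr_cost m2 (for_next k)).+1).+1 + t).+1; split=> //.
- apply: ExecWhileTrue g1 _ ex; apply: ExecSeq ex2 _.
  by rewrite -[X in update _ _ _ X]nx; apply: (ExecSet k (Const 0) (for_next k)).
- have c1 := expr_cost_le (for_guard k e) b0 bm1.
  have c2 := expr_cost_le (Const 0) b0 bm2.
  have c3 := expr_cost_le (for_next k) b0 bm2.
  by move: le; rewrite mulSn {3}/body; lia.
Qed.

End WeakestPrecondition.

(** * The algorithm *)

(* Arrays: 5 labels, 6 parts, 7 colors, 8 weights over a common denominator;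
   arrays from 10 on only serve as scalar variables, at index 0. *)
Local Notation size_var := (scalar 0).
Local Notation inner_var := (scalar 10).
Local Notation outer_var := (scalar 11).

Definition arc_expr i j := Get 1 (Bin Add (Bin Mul size_var i) j).

Definition sum_prog k c e :=
  PSeq (PSet k (Const 0) (Const 0))
       (PFor 10 size_var (PIf c (PSet k (Const 0) (Bin Add (scalar k) e)) PSkip)).

Definition spread_prog p q :=
  PFor 11 size_var
    (PIf (Bin Leq (Get 5 outer_var) (Const 1))
       (PSeq (sum_prog 12 (Bin Mul (Bin Eqn (Get 5 inner_var) p)
                                   (arc_expr inner_var outer_var)) (Const 1))
             (PIf (scalar 12) (PSet 5 outer_var q) PSkip))
       PSkip).

(* Variable 16 is the label of the candidates, 1 if there is a frontier and 0
   otherwise; it also selects the direction of the arcs that are counted. *)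
Definition mix_expr e1 e2 :=
  Bin Add (Bin Mul (scalar 16) e1) (Bin Mul (Bin Sub (Const 1) (scalar 16)) e2).

(** The number of vertices stands for no vertex, and its successor exceeds every degree, so that the
    first candidate is accepted. *)
Definition select_prog :=
  PSeq (PSet 13 (Const 0) size_var)
 (PSeq (PSet 14 (Const 0) (Bin Add size_var (Const 1)))
       (PFor 11 size_var
          (PIf (Bin Eqn (Get 5 outer_var) (scalar 16))
             (PSeq (sum_prog 15 (Bin Mul (Bin Eqn (Get 5 inner_var) (scalar 16))
                      (arc_expr (mix_expr inner_var outer_var)
                                (mix_expr outer_var inner_var))) (Const 1))
                   (PIf (Bin Leq (Bin Add (scalar 15) (Const 1)) (scalar 14))
                      (PSeq (PSet 13 (Const 0) outer_var)
                            (PSet 14 (Const 0) (scalar 15)))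
                      PSkip))
             PSkip))).

(** * Correctness of summation, spreading and selection *)

Section Primitives.
Variables (V : finType) (T : tournament V).

Definition rank (x : V) := index x (enum V).

Lemma rank_lt x : rank x < #|V|.
Proof. by rewrite cardE index_mem mem_enum. Qed.

Lemma rank_inj : injective rank.
Proof.
move=> x y e; have mx z : z \in enum V by rewrite mem_enum.
by rewrite -(nth_index x (mx x)) -(nth_index x (mx y)) -/(rank x) -/(rank y) e.
Qed.

Lemma rank_ex i : i < #|V| -> exists x, rank x = i.
Proof.
move=> lt; have lt' : i < size (enum V) by rewrite -cardE.
case s: (enum V) => [|x0 s0]; first by rewrite s in lt'.
by exists (nth x0 (enum V) i); rewrite /rank index_uniq // enum_uniq.
Qed.

Lemma rank_ltS x y : (rank y < (rank x).+1) = (y == x) || (rank y < rank x).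
Proof. by rewrite ltnS leq_eqVlt (inj_eq rank_inj). Qed.

Lemma sum_rankS x (F : V -> nat) :
  \sum_(y | rank y < (rank x).+1) F y = F x + \sum_(y | rank y < rank x) F y.
Proof.
rewrite (bigD1 x) /=; last by rewrite rank_ltS eqxx.
congr (_ + _); apply: eq_bigl => y; rewrite rank_ltS.
by case: eqVneq => [->|_]; rewrite ?ltnn ?andbT ?andbF.
Qed.

Lemma sum_rank (F : V -> nat) : \sum_(y | rank y < #|V|) F y = \sum_y F y.
Proof. by apply: eq_bigl => y; rewrite rank_lt. Qed.

Variables (b L : nat).
Hypotheses (b0 : 0 < b) (nL : #|V| + 9 <= L) (nb : #|V| + 16 < 2 ^ b).

Local Notation wp := (wp b L).

Definition graph (m : memory) :=
  m 0 0 = #|V| /\ forall x y, m 1 (#|V| * rank x + rank y) = T x y.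

Definition labels a (m : memory) (f : V -> nat) := forall x, m a (rank x) = f x.

Lemma wp_vertices k p m (I : nat -> memory -> Prop) :
  m 0 0 = #|V| -> k \notin writes p -> 0 \notin k :: writes p ->
  I 0 (update m k 0 0) ->
  (forall x m', m' k 0 = rank x ->
     (forall a i : nat, a \notin k :: writes p -> m' a i = m a i) -> I (rank x) m' ->
     wp p m' (fun m'' => I (rank x).+1 (update m'' k 0 (rank x).+1))) ->
  wp (PFor k size_var p) m (I #|V|).
Proof.
move=> m0 kp zp I0 step; apply: (@wp_for _ _ b0) => //; try by lia.
- by move=> m' fr; rewrite /= fr.
- by move=> j m' /rank_ex[x <-]; apply: step.
Qed.

Lemma wp_sum k c e m (P : pred V) (F : V -> nat) :
  m 0 0 = #|V| -> k != 0 -> k != 10 -> \sum_(x | P x) F x < 2 ^ b ->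
  (forall x m', m' 10 0 = rank x ->
    (forall a i : nat, a \notin [:: 10; k] -> m' a i = m a i) ->
    (eval m' c != 0) = P x /\ (P x -> eval m' e = F x)) ->
  wp (sum_prog k c e) m (fun m' => m' k 0 = \sum_(x | P x) F x).
Proof.
move=> m0 k0 k10 lt ev; apply: wp_seq => //; apply: wp_set => //=.
  by rewrite expn_gt0.
pose G x := if P x then F x else 0.
have GE : \sum_(x | P x) F x = \sum_x G x by rewrite big_mkcond.
have k0' : (0 == k) = false by rewrite eq_sym (negbTE k0).
have k10' : (10 == k) = false by rewrite eq_sym (negbTE k10).
set m1 := update m k 0 0.
apply: (@wp_conseq _ _ _ _ (fun m' => m' k 0 = \sum_(y | rank y < #|V|) G y)); last first.
  by move=> m' _ _ ->; rewrite sum_rank GE.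
apply: (@wp_vertices 10 _ m1 (fun i m' => m' k 0 = \sum_(y | rank y < i) G y)).
- by rewrite /m1 /update k0'.
- by rewrite /= !inE k10'.
- by rewrite /= !inE k0'.
- by rewrite /update (negbTE k10) /= /m1 /update !eqxx big_pred0.
move=> x m' mx fr sumx.
have fr' a i : a \notin [:: 10; k] -> m' a i = m a i.
  move=> ak; rewrite (fr a i ak).
  by move: ak; rewrite /m1 /update !inE negb_or => /andP[_ /negbTE ->].
have [ec ee] := ev x m' mx fr'.
have upd (m2 : memory) v : update m2 10 0 v k 0 = m2 k 0.
  by rewrite /update (negbTE k10).
apply: wp_if => // [|e0].
  rewrite ec => Px; apply: wp_set => //=; last first.
    by rewrite upd /update !eqxx /= sumx ee // sum_rankS /G Px addnC.
  rewrite sumx ee //; apply: leq_ltn_trans lt; rewrite GE.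
  have -> : F x = G x by rewrite /G Px.
  by rewrite addnC -sum_rankS [leqRHS](bigID (fun y => rank y < (rank x).+1)) /= leq_addr.
apply: wp_skip => //; rewrite upd sumx sum_rankS /G.
by move: ec; rewrite e0 /= => <-.
Qed.

Lemma wp_spread p q (pv qv : nat) m f :
  graph m -> labels 5 m f -> 1 < pv -> pv != qv -> qv < 2 ^ b ->
  (forall m' : memory, (forall a i : nat, a \notin [:: 5; 10; 11; 12] -> m' a i = m a i) ->
     eval m' p = pv /\ eval m' q = qv) ->
  wp (spread_prog p q) m (fun m' => labels 5 m' (spread T f pv qv)).
Proof.
move=> [m0 m1] lab p1 pq qb ev.
pose I i (m' : memory) := forall x,
  m' 5 (rank x) = if rank x < i then spread T f pv qv x else f x.
apply: (@wp_conseq _ _ _ _ (I #|V|)); last by move=> m' _ _ Im x; rewrite Im rank_lt.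
apply: wp_vertices => //.
move=> y m' my fr Iy.
have frame' a i : a \notin [:: 5; 10; 11; 12] -> m' a i = m a i.
  by move=> ha; apply: fr; move: ha; rewrite /= !inE; do !case: eqP.
have ev' (m2 : memory) s : (forall a i : nat, a \notin s -> m2 a i = m' a i) ->
    all (mem [:: 5; 10; 11; 12]) s -> eval m2 p = pv /\ eval m2 q = qv.
  move=> fr2 /allP sub; apply: ev => a i ha; rewrite fr2 ?frame' //.
  by apply: contraNN ha => /sub.
have stepI (m2 : memory) : (forall x, x != y -> m2 5 (rank x) = m' 5 (rank x)) ->
    m2 5 (rank y) = spread T f pv qv y -> I (rank y).+1 (update m2 11 0 (rank y).+1).
  move=> ne eq x; rewrite /update /= rank_ltS; case: eqVneq => [->//|xy].
  by rewrite ne // Iy.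
apply: wp_if => //= [|].
  rewrite my Iy ltnn -lt0n lt0b => fy.
  apply: wp_seq => //.
  pose P x := (f x == pv) && T x y.
  apply: (@wp_conseq _ _ _ _ (fun m2 => m2 12 0 = \sum_(x | P x) 1)).
    apply: wp_sum => //.
    - by rewrite frame'.
    - by rewrite sum1_card; apply: leq_ltn_trans (max_card _) _; lia.
    move=> x m2 mx fr2; split=> //=.
    have [-> _] := ev' m2 _ fr2 isT.
    rewrite mx !fr2 // my (frame' 0) // m0 (frame' 1) // m1 Iy.
    (* Labels are overwritten in place, but no vertex enters or leaves label [pv]: those changed had
       a label at most 1, below [pv], and receive [qv], distinct from [pv]. *)
    have -> : ((if rank x < rank y then spread T f pv qv x else f x) == pv) = (f x == pv).
      case: ifP => // _; rewrite /spread; case: ifP => // /andP[fx _].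
      by rewrite eq_sym (negbTE pq); lia.
    by rewrite /P; case: (f x == pv); case: (T x y).
  move=> m2 _ fr2 m2E; rewrite /= in fr2.
  have frE : spread T f pv qv y = if m2 12 0 != 0 then qv else f y.
    rewrite /spread fy m2E /=; congr (if _ then _ else _).
    by rewrite sum1_card -lt0n.
  apply: wp_if => //= [n0|z0].
    have [_ qE] := ev' m2 _ fr2 isT.
    apply: wp_set => //=; first by rewrite qE.
    rewrite qE fr2 // my; apply: stepI => [x xy|].
      by rewrite /update /= (inj_eq rank_inj) (negbTE xy) fr2.
    by rewrite /update /= eqxx frE n0.
  apply: wp_skip => //; apply: stepI => [x xy|]; first by rewrite fr2.
  by rewrite fr2 // Iy ltnn frE z0.
rewrite my Iy ltnn => /eqP; rewrite eqb0 => fy.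
apply: wp_skip => //; apply: stepI => //.
by rewrite Iy ltnn /spread (negbTE fy).
Qed.

Lemma wp_select s m f :
  graph m -> labels 5 m f -> m 16 0 = s -> s <= 1 ->
  wp select_prog m (fun m' => exists2 o, selected T f s o &
     m' 13 0 = if o is Some v then rank v else #|V|).
Proof.
move=> [m0 m1] lab ms s1; apply: wp_seq => //; apply: wp_set => //=; first by rewrite m0; lia.
apply: wp_seq => //; apply: wp_set => //=; first by rewrite /update /= m0; lia.
rewrite m0 [update m _ _ _ 0 0]/update /= m0 addn1; set m2 := update _ 14 _ _.
pose I i (m' : memory) :=
  [/\ m' 13 0 = #|V|, m' 14 0 = #|V|.+1 & forall x, rank x < i -> f x != s] \/
  exists v, [/\ m' 13 0 = rank v, m' 14 0 = degree T f s v, f v = s &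
     forall x, rank x < i -> f x = s -> degree T f s v <= degree T f s x].
apply: (@wp_conseq _ _ _ _ (I #|V|)); last first.
  move=> m' _ _ [[-> _ no]|[v [-> _ fv vmin]]].
    by exists None => //= x; apply: no; apply: rank_lt.
  by exists (Some v) => //; split=> // x; apply: vmin; apply: rank_lt.
have fr2 a i : a \notin [:: 13; 14] -> m2 a i = m a i.
  by rewrite /m2 /update !inE => /norP[/negbTE -> /negbTE ->].
apply: wp_vertices => //; first by left; rewrite /m2 /update /=.
move=> y m' my fr Iy.
have frame' a i : a \notin [:: 10; 11; 13; 14; 15] -> m' a i = m a i.
  move=> ha; rewrite fr ?fr2 //; move: ha; rewrite /= !inE; by do !case: eqP.
apply: wp_if => //=.
  rewrite my !frame' // lab ms eqb0 negbK => /eqP fy.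
  apply: wp_seq => //.
  pose P x := (f x == s) && (if s == 1 then T x y else T y x).
  have sumE : \sum_(x | P x) 1 = degree T f s y.
    by rewrite sum1_card /degree cardsE.
  apply: (@wp_conseq _ _ _ _ (fun m3 => m3 15 0 = degree T f s y)).
    rewrite -sumE; apply: wp_sum => //; first by rewrite frame'.
      by rewrite sum1_card; apply: leq_ltn_trans (max_card _) _; lia.
    move=> x m3 mx fr3; split=> //=.
    rewrite mx !fr3 // my !frame' // lab ms m0 /P.
    have [sE|sE] : s = 0 \/ s = 1 by lia.
      by rewrite sE !mul0n subn0 !mul1n !add0n m1; case: (f x == 0); case: (T y x).
    by rewrite sE subnn !mul0n !mul1n !addn0 m1; case: (f x == 1); case: (T x y).
  move=> m3 bm3 fr3 key; rewrite /= in fr3.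
  apply: wp_if => //=; rewrite key !fr3 // => cmp.
    apply: wp_seq => //; apply: wp_set => //=.
    rewrite fr3 // my; apply: wp_set => //; rewrite /update /= // key; right; exists y; split=> // x.
    rewrite rank_ltS => /predU1P[->//|xy] fx.
    have {}cmp : degree T f s y < m' 14 0 by move: cmp; case: (leqP _ (m' 14 0)); lia.
    case: Iy => [[_ _ /(_ x xy)]|[v [_ vd fv /(_ x xy fx)]]]; first by rewrite fx eqxx.
    by rewrite vd in cmp; lia.
  have {}cmp : m' 14 0 <= degree T f s y by move: cmp; case: (leqP _ (m' 14 0)); lia.
  apply: wp_skip => //; rewrite /update /= /I /= !fr3 //.
  case: Iy => [[_ e _]|[v [-> vd fv vmin]]].
    by move: cmp; rewrite e ltnNge max_card.
  right; exists v; split=> // x; rewrite rank_ltS => /predU1P[->|]; last exact: vmin.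
  by rewrite -vd.
rewrite my !frame' // lab ms => /eqP; rewrite eqb0 => fy.
apply: wp_skip => //; case: Iy => [[e13 e14 no]|[v [e13 e14 fv vmin]]]; rewrite /I /update /=.
  by left; split=> // x; rewrite rank_ltS => /predU1P[->//|]; apply: no.
right; exists v; split=> // x; rewrite rank_ltS => /predU1P[->|]; last exact: vmin.
by move=> fy'; rewrite fy' eqxx in fy.
Qed.

End Primitives.

(** * Programs for the parts and their layers *)

Local Notation "p ;; q" := (PSeq p q) (at level 90, right associativity).

Definition mod3_expr e := Bin Sub e (Bin Mul (Const 3) (Bin Div e (Const 3))).

Lemma eval_mod3 m e : eval m (mod3_expr e) = eval m e %% 3.
Proof. by rewrite /=; lia. Qed.

Definition count_label_prog e :=
  sum_prog 12 (Bin Eqn (Get 5 inner_var) e) (Const 1).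

Definition split_body :=
  count_label_prog (Const 1) ;;
  PSet 16 (Const 0) (Bin Leq (Const 1) (scalar 12)) ;;
  select_prog ;;
  PSet 5 (scalar 13) (Const 2) ;;
  spread_prog (Const 2) (Const 5) ;;
  spread_prog (Const 5) (scalar 18) ;;
  spread_prog (scalar 18) (Const 1) ;;
  PSet 18 (Const 0) (Bin Sub (Const 7) (scalar 18)).

Definition split_prog :=
  PSet 18 (Const 0) (Const 3) ;; PFor 17 size_var split_body.

Definition layer_body :=
  spread_prog (Bin Sub (scalar 20) (Const 1)) (scalar 20) ;;
  count_label_prog (scalar 20) ;;
  PIf (scalar 12) PSkip
    (PSet 16 (Const 0) (Const 0) ;; select_prog ;; PSet 5 (scalar 13) (scalar 20)) ;;
  PSet 20 (Const 0) (Bin Add (scalar 20) (Const 1)).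

Definition layer_prog :=
  PFor 10 size_var
    (PSet 5 inner_var (Bin Mul (Const 2)
       (Bin Sub (Const 1) (Bin Eqn (Get 6 inner_var) (scalar 19))))) ;;
  PSet 20 (Const 0) (Const 4) ;;
  PFor 17 size_var layer_body ;;
  PFor 10 size_var
    (PIf (Bin Eqn (Get 6 inner_var) (scalar 19))
       (PSet 7 inner_var (Bin Add (Bin Mul (Const 3) (scalar 19))
                                  (mod3_expr (Get 5 inner_var))))
       PSkip).

Definition color_prog :=
  split_prog ;;
  PFor 10 size_var (PSet 6 inner_var (mod3_expr (Get 5 inner_var))) ;;
  PFor 19 (Const 3) layer_prog.

Section Coloring.
Variables (V : finType) (T : tournament V).
Variables (b L : nat).
Implicit Types (f : V -> nat) (m : memory).
Hypotheses (b0 : 0 < b) (nL : #|V| + 9 <= L) (nb : #|V| + 16 < 2 ^ b).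

Local Notation wp := (wp b L).
Local Notation graph := (graph T).
Local Notation rank := (@rank V).

Lemma graph_agree (s : seq nat) (m m' : memory) :
  (forall a i : nat, a \notin s -> m' a i = m a i) -> 0 \notin s -> 1 \notin s ->
  graph m -> graph m'.
Proof. by move=> fr s0 s1 [m0 m1]; split=> [|x y]; rewrite fr. Qed.

Lemma wp_count_label (v : nat) e m f : m 0 0 = #|V| -> labels 5 m f ->
  (forall m' : memory, (forall a i : nat, a \notin [:: 10; 12] -> m' a i = m a i) ->
     eval m' e = v) ->
  wp (count_label_prog e) m (fun m' => (0 < m' 12 0) = [exists x, f x == v]).
Proof.
move=> m0 lab ev.
apply: (@wp_conseq _ _ _ _ (fun m' => m' 12 0 = \sum_(x | f x == v) 1)).
  apply: (wp_sum b0 nL nb) => //.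
    by rewrite sum1_card; apply: leq_ltn_trans (max_card _) _; lia.
  move=> x m' mx fr; split=> //=; rewrite (ev m' fr) mx fr // lab.
  by case: (f x == v).
by move=> m' _ _ ->; rewrite sum1_card; apply/card_gt0P/existsP.
Qed.

(** If no vertex was selected, the write lands just behind the last label and is harmless. *)
Lemma labels_relabel m f o i v : labels 5 m f ->
  i = (if o is Some x then rank x else #|V|) ->
  labels 5 (update m 5 i v) (relabel f o v).
Proof.
move=> lab -> x; rewrite /update /= /relabel; case: o => [y|] /=.
  by rewrite (inj_eq (@rank_inj V)) (inj_eq (@Some_inj _)) lab.
by rewrite ltn_eqF ?rank_lt // lab.
Qed.

(** As many rounds as vertices suffice: a round places at least its pivot, and one without a pivot
    finds nothing left to place. *)
Lemma split_step_count j f o : fvs_bounded T 3 setT -> split_invariant T j f ->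
  selected T f (frontier f) o ->
  split_invariant T (7 - j) (split_step T j f o) /\
  forall r, #|[set y | f y <= 1]| <= #|V| - r ->
    #|[set y | split_step T j f o y <= 1]| <= #|V| - r.+1.
Proof.
move=> bT inv sel; case: o sel => [v|] sel.
  split=> [|r]; first exact: split_step_some.
  by have := split_step_progress inv sel; lia.
split=> [|r _]; first exact: split_step_none.
suff -> : [set y | split_step T j f None y <= 1] = set0 by rewrite cards0.
apply/setP=> y; rewrite !inE (split_step_idle _ sel) leqNgt.
by rewrite (selected_none sel).
Qed.

Lemma wp_split m : fvs_bounded T 3 setT -> graph m -> (forall i, m 5 i = 0) ->
  wp split_prog m (fun m' => exists f, [/\ labels 5 m' f, forall x, 1 < f x &
    forall c, c < 3 -> fvs_bounded T 2 (color_class f c)]).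
Proof.
move=> bT gm m5; apply: wp_seq => //; apply: wp_set => //=; first by lia.
pose I r (m' : memory) := exists j f, [/\ m' 18 0 = j, labels 5 m' f,
  split_invariant T j f & #|[set y | f y <= 1]| <= #|V| - r].
apply: (@wp_conseq _ _ _ _ (I #|V|)); last first.
  move=> m' _ _ [j [f [_ lab inv]]]; rewrite subnn leqn0 cards_eq0 => /eqP W0.
  exists f; split=> //; last exact: split_class inv.
  by move=> x; move/setP/(_ x): W0; rewrite !inE leqNgt => /negbFE.
apply: (wp_vertices b0 nL nb) => //; first by rewrite /update /=; case: gm.
  exists 3, (fun=> 0); rewrite /update /=.
  by split=> [|y||]; [| apply: m5 | apply: split_init | rewrite subn0 max_card].
move=> x m1 mx fr1 [j [f [m18 lab inv cW]]].
have g1 : graph m1.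
  by apply: (graph_agree fr1) => //; split=> *; rewrite /update /=; case: gm => [? ->].
have j34 := split_code inv.
apply: wp_seq => //; apply: wp_conseq.
  by apply: (@wp_count_label 1) lab _ => //; case: g1.
move=> m2 _ fr2 cnt; apply: wp_seq => //; apply: wp_set => //=.
  by apply: leq_ltn_trans (leq_b1 _) _; lia.
rewrite cnt -/(frontier f); set m3 := update m2 _ _ _.
have fr3 a i : a \notin [:: 10; 12; 16] -> m3 a i = m1 a i.
  rewrite /m3 /update !inE => /norP[a10 /norP[a12 /negbTE ->]] /=.
  by rewrite fr2 // !inE !negb_or a10 a12.
have g3 : graph m3 by apply: graph_agree fr3 _ _ g1.
have lab3 : labels 5 m3 f by move=> y; rewrite fr3.
apply: wp_seq => //; apply: wp_conseq.
  by apply: (@wp_select _ T _ _ b0 nL nb (frontier f)) lab3 _ _ => //; apply: leq_b1.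
move=> m4 _ fr4 [o sel e13]; rewrite /= in fr4.
apply: wp_seq => //; apply: wp_set => //=; first by lia.
rewrite {1}e13; set m5' := update m4 _ _ _.
have g5 : graph m5'.
  have g4 : graph m4 by apply: graph_agree fr4 _ _ g3.
  by case: g4 => *; split=> *; rewrite /m5' /update /=.
have lab5 : labels 5 m5' (relabel f o 2).
  by apply: labels_relabel => // y; rewrite fr4.
have m18' : m5' 18 0 = j by rewrite /m5' /update /= fr4 // fr3.
apply: wp_seq => //; apply: wp_conseq.
  by apply: (@wp_spread _ T _ _ b0 nL nb _ _ 2 5) lab5 _ _ _ _ => //; lia.
move=> m6 _ fr6 lab6; have g6 : graph m6 by apply: graph_agree fr6 _ _ g5.
apply: wp_seq => //; apply: wp_conseq.
  apply: (@wp_spread _ T _ _ b0 nL nb _ _ 5 j) lab6 _ _ _ _ => //.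
  - by case: j34 => ->.
  - by case: j34 => ->; lia.
  - by move=> m' fr; rewrite /= fr // fr6.
move=> m7 _ fr7 lab7; have g7 : graph m7 by apply: graph_agree fr7 _ _ g6.
apply: wp_seq => //; apply: wp_conseq.
  apply: (@wp_spread _ T _ _ b0 nL nb _ _ j 1) lab7 _ _ _ _ => //.
  - by case: j34 => ->.
  - by case: j34 => ->.
  - by lia.
  - by move=> m' fr; rewrite /= fr // fr7 // fr6.
move=> m8 _ fr8 lab8; apply: wp_set => //=; first by case: j34; lia.
have [inv' cnt'] := split_step_count bT inv sel.
exists (7 - j), (split_step T j f o); split=> //.
- by rewrite /update /= fr8 // fr7 // fr6 // m18'.
- exact: cnt'.
Qed.

(** While vertices remain, each round places one, either in a nonempty new layer or as a root. *)
Lemma layer_step_count (C : {set V}) t B o : 4 <= t -> layer_invariant T C t B ->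
  selected T (spread T B t.-1 t) 0 o ->
  forall r, #|[set y | B y == 0]| <= #|V| - r ->
    #|[set y | layer_step T t B o y == 0]| <= #|V| - r.+1.
Proof.
move=> t4 inv sel r; rewrite /layer_step; set g := spread T B t.-1 t in sel *.
have g0 y : g y == 0 -> B y == 0.
  by rewrite /g /spread; case: ifP => // _ /eqP t0; rewrite t0 in t4.
have strict y (h : V -> nat) : B y == 0 -> h y != 0 -> (forall z, h z == 0 -> B z == 0) ->
    #|[set y | h y == 0]| < #|[set y | B y == 0]|.
  move=> by0 hy hB; apply: proper_card; apply/properP; split.
    by apply/subsetP=> z; rewrite !inE; apply: hB.
  by exists y; rewrite inE.
case: existsP => [[y /eqP gy]|no].
  have by0 : B y == 0.
    have := layer_code inv y; move: gy; rewrite /g /spread; case: ifP => [/andP[+ _] _|_].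
      by case: (B y) => [//|[|?]] // _ []; lia.
    by move=> e [] /eqP; lia.
  by have := strict y g by0 (_ : g y != 0) g0; rewrite gy; lia.
case: o sel => [u [gu _]|no0].
  have bu : B u == 0 by apply: g0; rewrite gu.
  have ru : relabel g (Some u) t u != 0 by rewrite /relabel eqxx; lia.
  have := strict u (relabel g (Some u) t) bu ru.
  have rB z : relabel g (Some u) t z == 0 -> B z == 0.
    by rewrite /relabel; case: ifP => _; [lia | apply: g0].
  by move=> /(_ rB); lia.
suff -> : [set y | relabel g None t y == 0] = set0 by rewrite cards0.
by apply/setP=> y; rewrite !inE /relabel /=; apply/negbTE.
Qed.

Lemma wp_layer c m (G : V -> nat) : graph m -> labels 6 m G -> m 19 0 = c -> c < 3 ->
  fvs_bounded T 2 [set x | G x == c] ->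
  wp layer_prog m (fun m' => exists t B,
    [/\ layer_invariant T [set x | G x == c] t B, forall x, B x != 0 &
     forall x, m' 7 (rank x) = if G x == c then 3 * c + B x %% 3 else m 7 (rank x)]).
Proof.
move=> gm labG m19 c3 bC; set C := [set x | G x == c].
pose B0 (x : V) := if x \in C then 0 else 2.
apply: wp_seq => //; apply: (@wp_conseq _ _ _ _
  (fun m' => forall x, rank x < #|V| -> m' 5 (rank x) = B0 x)).
  apply: (wp_vertices b0 nL nb (I := fun i m' => forall x, rank x < i -> m' 5 (rank x) = B0 x)) => //.
    by case: gm.
  move=> x m1 mx fr Ix; rewrite /= in fr; apply: wp_set => //=.
    by rewrite mx !fr // labG; case: eqP => _; lia.
  rewrite mx !fr // labG m19 => y; rewrite /update /= rank_ltS (inj_eq (@rank_inj V)).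
  case: eqVneq => [->|_]; last exact: Ix.
  by rewrite /B0 inE; case: eqP.
move=> m1 _ fr1 lab1; rewrite /= in fr1; apply: wp_seq => //; apply: wp_set => //=; first by lia.
set m2 := update m1 _ _ _.
have fr2 a i : a \notin [:: 5; 10; 20] -> m2 a i = m a i.
  rewrite /m2 /update !inE => /norP[a5 /norP[a10 /negbTE ->]] /=.
  by rewrite fr1 // !inE !negb_or a5 a10.
have g2 : graph m2 by apply: graph_agree fr2 _ _ gm.
pose I r m' := exists B, [/\ labels 5 m' B, m' 20 0 = r + 4,
  layer_invariant T C (r + 4) B & #|[set y | B y == 0]| <= #|V| - r].
apply: wp_seq => //; apply: (@wp_conseq _ _ _ _ (I #|V|)).
  apply: (wp_vertices b0 nL nb) => //; first by case: g2.
    exists B0; split=> //; last by rewrite subn0 max_card.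
    - by move=> x; rewrite /m2 /update /= lab1 // rank_lt.
    - exact: layer_init.
  move=> x m3 mx fr3 [B [labB m20 inv cB]]; rewrite /= in fr3.
  set r := rank x in m20 inv cB *; set t := r + 4 in m20 inv.
  have tb : t.+1 < 2 ^ b by have := rank_lt x; rewrite -/r /t; lia.
  have t4 : 4 <= t by rewrite /t; lia.
  have g3 : graph m3 by apply: graph_agree fr3 _ _ g2.
  apply: wp_seq => //; apply: wp_conseq.
    apply: (@wp_spread _ T _ _ b0 nL nb _ _ t.-1 t) labB _ _ _ _ => //; try by lia.
    by move=> m' fr; rewrite /= fr // m20 subn1.
  move=> m4 _ fr4 lab4; rewrite /= in fr4; set g := spread T B t.-1 t in lab4.
  have m420 : m4 20 0 = t by rewrite fr4.
  have g4 : graph m4 by apply: graph_agree fr4 _ _ g3.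
  apply: wp_seq => //; apply: wp_conseq.
    apply: (@wp_count_label t) lab4 _; first by case: g4.
    by move=> m' fr; rewrite /= fr.
  move=> m5 _ fr5 cnt; rewrite /= in fr5.
  have m520 : m5 20 0 = t by rewrite fr5.
  have g5 : graph m5 by apply: graph_agree fr5 _ _ g4.
  have lab5 : labels 5 m5 g by move=> y; rewrite fr5.
  apply: wp_seq => //.
  apply: (@wp_conseq _ _ _ _ (fun m6 => m6 20 0 = t /\
     exists2 o, selected T g 0 o & labels 5 m6 (layer_step T t B o))).
    rewrite /layer_step -/g; apply: wp_if => //=.
      rewrite -lt0n cnt => ex; apply: wp_skip => //; split=> //.
      (* The program selects nothing in this branch. A minimiser is supplied for the statements
         about [layer_step], which speak of a selected vertex in both branches. *)
      have [o sel] : exists o, selected T g 0 o.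
        have [/existsP[u /eqP gu]|/existsPn no] := boolP [exists u, g u == 0].
          have Pu : g u == 0 by apply/eqP.
          case: (@arg_minnP _ u (fun v => g v == 0) (fun v => degree T g 0 v) Pu).
          by move=> v /eqP gv vmin; exists (Some v); split=> // y /eqP; apply: vmin.
        by exists None.
      by exists o => //; rewrite ex.
    move=> z; have /negbTE no : ~~ [exists x, g x == t] by rewrite -cnt z.
    apply: wp_seq => //; apply: wp_set => //=; first by rewrite expn_gt0.
    set m6 := update m5 _ _ _.
    have g6 : graph m6 by case: g5 => *; split=> *; rewrite /m6 /update /=.
    apply: wp_seq => //; apply: wp_conseq.
      by apply: (@wp_select _ T _ _ b0 nL nb 0 m6 g) => //; move=> y; rewrite /m6 /update /= lab5.
    move=> m7 _ fr7 [o sel e13]; rewrite /= in fr7.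
    have m720 : m7 20 0 = t by rewrite fr7.
    apply: wp_set => //=; first by rewrite m720; lia.
    split; first by rewrite /update /= m720.
    exists o => //; rewrite no m720; apply: labels_relabel => // y.
    by rewrite fr7 // /m6 /update /= lab5.
  move=> m6 _ fr6 [m620 [o sel lab6]]; apply: wp_set => //=; first by rewrite m620; lia.
  exists (layer_step T t B o); split.
  - by move=> y; rewrite /update /= lab6.
  - by rewrite /update /= m620 /t; lia.
  - by rewrite addSn; apply: layer_step_invariant.
  - exact: (layer_step_count t4 inv sel).
move=> m3 _ fr3 [B [labB _ inv]]; rewrite /= in fr3.
rewrite subnn leqn0 cards_eq0 => /eqP B_0.
have Bn0 x : B x != 0 by move/setP/(_ x): B_0; rewrite !inE => ->.
have fr3' a i : a \notin [:: 5; 10; 11; 12; 13; 14; 15; 16; 17; 20] -> m3 a i = m a i.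
  move=> ha; rewrite fr3 ?fr2 //; first by move: ha; rewrite !inE; do !case: eqP.
  by move: ha; rewrite !inE; do !case: eqP.
apply: (@wp_conseq _ _ _ _ (fun m' => forall x, m' 7 (rank x) =
   if (rank x < #|V|) && (G x == c) then 3 * c + B x %% 3 else m 7 (rank x))); last first.
  move=> m' _ _ E; exists (#|V| + 4), B; split=> // x.
  by rewrite E rank_lt.
apply: (wp_vertices b0 nL nb (I := fun i m' => forall x, m' 7 (rank x) =
   if (rank x < i) && (G x == c) then 3 * c + B x %% 3 else m 7 (rank x))) => //.
- by rewrite fr3' //; case: gm.
- by move=> x; rewrite /update /= fr3'.
move=> x m4 mx fr4 Ix; rewrite /= in fr4.
have e6 : m4 6 (rank x) = G x by rewrite fr4 // fr3'.
have e19 : m4 19 0 = c by rewrite fr4 // fr3'.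
have e5 : m4 5 (rank x) = B x by rewrite fr4.
have xx : (rank x < rank x) = false by rewrite ltnn.
apply: wp_if => //; rewrite [eval _ _]/= mx e6 e19; case: (G x =P c) => //= Gx _.
  apply: wp_set => //; rewrite /= ?mx ?e5 ?e19.
    by have := ltn_pmod (B x) (isT : 0 < 3); lia.
  move=> y; rewrite /update /= rank_ltS (inj_eq (@rank_inj V)).
  case: eqVneq => [->|_]; last exact: Ix.
  by rewrite Gx eqxx /=; lia.
apply: wp_skip => // y; rewrite /update /= rank_ltS Ix; case: (eqVneq y x) => [->|//].
by rewrite xx; move/eqP/negbTE: Gx => ->; rewrite andbF.
Qed.

End Coloring.

(** * Integer weights and the best of nine candidates *)

Definition weight_prog :=
  PSet 21 (Const 0) (Const 1) ;;
  PFor 10 size_var (PSet 21 (Const 0) (Bin Mul (scalar 21) (Get 3 inner_var))) ;;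
  PFor 10 size_var (PSet 8 inner_var
    (Bin Mul (Get 2 inner_var) (Bin Div (scalar 21) (Get 3 inner_var)))).

(* Candidate s keeps the vertices of part s %/ 3 except one layer class. *)
Definition keep_expr s :=
  Bin Mul (Bin Eqn (Bin Div (Get 7 inner_var) (Const 3)) (Bin Div s (Const 3)))
          (Bin Sub (Const 1) (Bin Eqn (Get 7 inner_var) s)).

Definition best_prog :=
  PSet 24 (Const 0) (Const 0) ;;
  PSet 25 (Const 0) (Const 0) ;;
  PFor 22 (Const 9)
    (sum_prog 23 (keep_expr (scalar 22)) (Get 8 inner_var) ;;
     PIf (Bin Leq (scalar 24) (scalar 23))
       (PSet 24 (Const 0) (scalar 23) ;; PSet 25 (Const 0) (scalar 22)) PSkip).

Definition output_prog :=
  PFor 10 size_var (PSet 4 inner_var (Bin Sub (Const 1) (keep_expr (scalar 25)))).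

Definition main_prog := color_prog ;; weight_prog ;; best_prog ;; output_prog.

Section Selection.
Variables (V : finType) (T : tournament V).
Variables (b L : nat).
Implicit Types (f : V -> nat) (m : memory).
Hypotheses (b0 : 0 < b) (nL : #|V| + 9 <= L) (nb : #|V| + 16 < 2 ^ b).

Local Notation wp := (wp b L).
Local Notation graph := (graph T).
Local Notation rank := (@rank V).

Definition kept (col : V -> nat) s := [set x | (col x %/ 3 == s %/ 3) && (col x != s)].

Lemma wp_color m : fvs_bounded T 3 setT -> graph m -> (forall i, m 5 i = 0) ->
  wp color_prog m (fun m' => exists col, [/\ labels 7 m' col, forall x, col x < 9 &
    forall s, s < 9 -> acyclic T (kept col s)]).
Proof.
move=> bT gm m5; apply: wp_seq => //; apply: wp_conseq; first exact: (wp_split b0 nL nb bT gm m5).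
move=> m1 _ fr1 [f [labf f2 bcls]]; have g1 : graph m1 by apply: graph_agree fr1 _ _ gm.
pose G x := f x %% 3.
apply: wp_seq => //; apply: (@wp_conseq _ _ _ _
   (fun m' => forall x, rank x < #|V| -> m' 6 (rank x) = G x)).
  apply: (wp_vertices b0 nL nb (I := fun i m' => forall x, rank x < i -> m' 6 (rank x) = G x)) => //.
    by case: g1.
  move=> x m2 mx fr2 Ix; rewrite /= in fr2.
  have e5 : m2 5 (rank x) = f x by rewrite fr2.
  apply: wp_set => //; rewrite eval_mod3 /= mx e5; first by have := ltn_pmod (f x) (isT : 0 < 3); lia.
  move=> y; rewrite /update /= rank_ltS (inj_eq (@rank_inj V)).
  by case: eqVneq => [->//|_]; apply: Ix.
move=> m2 _ fr2 lab6; rewrite /= in fr2.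
have g2 : graph m2 by apply: graph_agree fr2 _ _ g1.
pose I c m' := forall c', c' < c -> exists t B,
  [/\ layer_invariant T [set x | G x == c'] t B, forall x, B x != 0 &
      forall x, G x = c' -> m' 7 (rank x) = 3 * c' + B x %% 3].
have clsE c : c < 3 -> fvs_bounded T 2 [set x | G x == c].
  move=> /bcls; suff -> : color_class f c = [set x | G x == c] by [].
  by apply/setP=> x; rewrite !inE f2.
apply: (@wp_conseq _ _ _ _ (I 3)).
  apply: (@wp_for _ _ b0) => //; [by lia | by lia |].
  move=> c m3 c3 m19 fr3 Ic.
  have g3 : graph m3 by apply: graph_agree fr3 _ _ g2.
  apply: wp_conseq.
    apply: (@wp_layer _ T _ _ b0 nL nb c m3 G) => //; last exact: clsE.
    by move=> x; rewrite fr3 // lab6 // rank_lt.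
  move=> m4 _ fr4 [t [B [inv Bn0 E]]] c'; rewrite ltnS leq_eqVlt => /predU1P[->|lt].
    by exists t, B; split=> // x Gx; rewrite /update /= E Gx eqxx.
  have [t' [B' [inv' Bn0' E']]] := Ic c' lt; exists t', B'; split=> // x Gx.
  by rewrite /update /= E Gx ltn_eqF // E'.
move=> m3 _ fr3 I3; exists (fun x => m3 7 (rank x)).
have G3 x : G x < 3 by apply: ltn_pmod.
have colE x : exists2 r : nat, r < 3 & m3 7 (rank x) = 3 * G x + r.
  have [t [B [_ _ E]]] := I3 (G x) (G3 x).
  by exists (B x %% 3); [apply: ltn_pmod | apply: E].
split=> // [x|s s9].
  by have [r r3 ->] := colE x; have := G3 x; lia.
have s3 : s %/ 3 < 3 by lia.
have [t [B [inv Bn0 E]]] := I3 _ s3.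
have r3 : s %% 3 < 3 by apply: ltn_pmod.
apply: acyclicS (layer_acyclic inv Bn0 r3); apply/subsetP=> x; rewrite !inE.
have [r r3' Ex] := colE x; rewrite Ex => /andP[/eqP dx nx].
have Gx : G x = s %/ 3 by have := G3 x; lia.
rewrite Gx eqxx /=; apply: contraNneq nx => eB.
by rewrite -Ex (E x Gx) eB; lia.
Qed.

Variables (num den : V -> nat).
Hypothesis den_gt0 : forall x, 0 < den x.
Let D := \prod_x den x.
(** The product of all denominators serves as common denominator. It need not be the least one, as
    its length is still bounded by the input size. *)
Definition scaled x := num x * (D %/ den x).
Hypotheses (hD : D < 2 ^ b) (hW : \sum_x scaled x < 2 ^ b).

Lemma wp_weight m : m 0 0 = #|V| -> labels 2 m num -> labels 3 m den ->
  wp weight_prog m (fun m' => labels 8 m' scaled).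
Proof.
move=> m0 lab2 lab3; apply: wp_seq => //; apply: wp_set => //=; first by lia.
have prodS x : \prod_(y | rank y < (rank x).+1) den y =
    \prod_(y | rank y < rank x) den y * den x.
  rewrite (bigD1 x) /=; last by rewrite rank_ltS eqxx.
  rewrite mulnC; congr (_ * _); apply: eq_bigl => y; rewrite rank_ltS.
  by case: eqVneq => [->|_]; rewrite ?ltnn ?andbT ?andbF.
have prodE : \prod_(y | rank y < #|V|) den y = D.
  by apply: eq_bigl => y; rewrite rank_lt.
(* Denominators are positive, so the partial products held during the loop also fit in [b] bits. *)
have prod_le i : \prod_(y | rank y < i) den y <= D.
  rewrite /D [leqRHS](bigID (fun y => rank y < i)) /= leq_pmulr //.
  by apply: prodn_cond_gt0.
apply: wp_seq => //; apply: (@wp_conseq _ _ _ _ (fun m' => m' 21 0 = D)).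
  rewrite -prodE; apply: (wp_vertices b0 nL nb
    (I := fun i m' => m' 21 0 = \prod_(y | rank y < i) den y)) => //.
    by rewrite /update /= big_pred0.
  move=> x m1 mx fr1 Ix; rewrite /= in fr1.
  have e3 : m1 3 (rank x) = den x by rewrite fr1 // /update /= lab3.
  apply: wp_set => //; rewrite /= mx e3 Ix -prodS //.
  exact: leq_ltn_trans (prod_le _) hD.
move=> m1 _ fr1 e21; rewrite /= in fr1.
have fr1' a i : a \notin [:: 10; 21] -> m1 a i = m a i.
  by move=> ha; rewrite fr1 // /update; move: ha; rewrite !inE => /norP[_ /negbTE ->].
apply: (@wp_conseq _ _ _ _ (fun m' => forall x, rank x < #|V| -> m' 8 (rank x) = scaled x)); last first.
  by move=> m' _ _ E x; rewrite E ?rank_lt.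
apply: (wp_vertices b0 nL nb (I := fun i m' => forall x, rank x < i -> m' 8 (rank x) = scaled x)) => //.
  by rewrite fr1'.
move=> x m2 mx fr2 Ix; rewrite /= in fr2.
have e2 : m2 2 (rank x) = num x by rewrite fr2 // fr1'.
have e3 : m2 3 (rank x) = den x by rewrite fr2 // fr1'.
have e21' : m2 21 0 = D by rewrite fr2.
apply: wp_set => //; rewrite /= mx e2 e3 e21' -/(scaled x).
  by apply: leq_ltn_trans hW; rewrite (bigD1 x) //= leq_addr.
move=> y; rewrite /update /= rank_ltS (inj_eq (@rank_inj V)).
by case: eqVneq => [->//|_]; apply: Ix.
Qed.

Definition kept_weight col s := \sum_(x in kept col s) scaled x.

Lemma eval_keep m x col s e : m 10 0 = rank x -> m 7 (rank x) = col x -> eval m e = s ->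
  eval m (keep_expr e) = (x \in kept col s).
Proof.
move=> mx m7 es; rewrite /= mx m7 es inE.
by case: (_ == s %/ 3); case: (col x == s).
Qed.

Lemma wp_best m col : m 0 0 = #|V| -> labels 7 m col -> labels 8 m scaled ->
  wp best_prog m (fun m' => m' 25 0 < 9 /\
     forall s, s < 9 -> kept_weight col s <= kept_weight col (m' 25 0)).
Proof.
move=> m0 lab7 lab8; apply: wp_seq => //; apply: wp_set => //=; first by lia.
apply: wp_seq => //; apply: wp_set => //=; first by lia.
set m1 := update _ 25 _ _.
pose I i m' := [/\ m' 25 0 < 9, i = 0 -> m' 24 0 = 0, 0 < i -> m' 24 0 = kept_weight col (m' 25 0) &
   forall s, s < i -> kept_weight col s <= m' 24 0].
apply: (@wp_conseq _ _ _ _ (I 9)); last first.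
  by move=> m' _ _ [? _ e le]; split=> // s /le; rewrite e.
apply: (@wp_for _ _ b0) => //; [by lia | by lia |].
move=> i m2 i9 mi fr2 [s9 e0 e24 le].
have fr2' a j : a \notin [:: 10; 22; 23; 24; 25] -> m2 a j = m a j.
  move=> ha; rewrite fr2 ?/m1 ?/update; move: ha; rewrite /= !inE; do !case: eqP => //.
have swl s : kept_weight col s < 2 ^ b.
  apply: leq_ltn_trans hW; rewrite /kept_weight [leqRHS](bigID (fun x => x \in kept col s)) /=.
  exact: leq_addr.
apply: wp_seq => //; apply: (@wp_conseq _ _ _ _ (fun m' => m' 23 0 = kept_weight col i)).
  apply: (wp_sum b0 nL nb) => //; [by rewrite fr2' | exact: swl |].
  move=> x m3 mx fr3; split.
    by rewrite (@eval_keep m3 x col i) ?eqb0 ?negbK //= fr3 // fr2'.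
  by move=> _; rewrite /= mx fr3 // fr2' // lab8.
move=> m3 bm3 fr3 e23; rewrite /= in fr3.
apply: wp_if => //=; rewrite e23 !fr3 //.
  rewrite -lt0n lt0b => cmp; apply: wp_seq => //; apply: wp_set => //=.
  apply: wp_set => //=; rewrite /update //= fr3 // mi e23.
  split=> // s; rewrite ltnS leq_eqVlt => /predU1P[->//|/le]; by move/leq_trans; apply.
move=> /eqP; rewrite eqb0 -ltnNge => cmp; apply: wp_skip => //.
rewrite /I /update /= !fr3 //; split=> //.
  (* The candidate 0 never takes this branch: the stored maximum is then 0, and no weight is
     smaller. *)
  by move=> _; apply: e24; rewrite lt0n; apply: contraTneq cmp => /e0 ->.
by move=> s; rewrite ltnS leq_eqVlt => /predU1P[->|/le//]; apply: ltnW.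
Qed.

Lemma wp_main m : fvs_bounded T 3 setT -> graph m -> (forall i, m 5 i = 0) ->
  labels 2 m num -> labels 3 m den ->
  wp main_prog m (fun m' => exists col s,
    [/\ acyclic T (kept col s), forall x, col x < 9,
        forall s', s' < 9 -> kept_weight col s' <= kept_weight col s &
        forall x, m' 4 (rank x) = (x \notin kept col s)]).
Proof.
move=> bT gm m5 lab2 lab3.
apply: wp_seq => //; apply: wp_conseq; first exact: (wp_color bT gm m5).
move=> m1 _ fr1 [col [lab7 col9 acyc]].
have g1 : graph m1 by apply: graph_agree fr1 _ _ gm.
apply: wp_seq => //; apply: wp_conseq.
  by apply: wp_weight; [case: g1 | move=> x; rewrite fr1 | move=> x; rewrite fr1].
move=> m2 _ fr2 lab8; have g2 : graph m2 by apply: graph_agree fr2 _ _ g1.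
apply: wp_seq => //; apply: wp_conseq.
  by apply: (@wp_best _ col) lab8; [case: g2 | move=> x; rewrite fr2].
move=> m3 _ fr3 [s9 smax]; have g3 : graph m3 by apply: graph_agree fr3 _ _ g2.
set s := m3 25 0 in s9 smax.
apply: (@wp_conseq _ _ _ _ (fun m' => forall x, rank x < #|V| -> m' 4 (rank x) = (x \notin kept col s))); last first.
  move=> m' _ _ E; exists col, s; split=> //; first exact: acyc.
  by move=> x; rewrite E ?rank_lt.
apply: (wp_vertices b0 nL nb (I := fun i m' => forall x, rank x < i ->
   m' 4 (rank x) = (x \notin kept col s))) => //; first by case: g3.
move=> x m4 mx fr4 Ix; rewrite /= in fr4.
have ek : eval m4 (keep_expr (scalar 25)) = (x \in kept col s).
  by apply: eval_keep => //; rewrite /= fr4 // fr3 // fr2.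
apply: wp_set => //.
  by apply: leq_ltn_trans (leq_subr _ _) _ => /=; lia.
have -> : eval m4 (Bin Sub (Const 1) (keep_expr (scalar 25))) = (x \notin kept col s).
  by rewrite [LHS]/= -[X in 1 - X]/(eval m4 (keep_expr (scalar 25))) ek; case: (x \in kept col s).
move=> y; rewrite /= mx /update /= rank_ltS (inj_eq (@rank_inj V)).
by case: eqVneq => [->//|_]; apply: Ix.
Qed.

(** A vertex of colour c is kept exactly by the two other candidates having the same quotient by 3
    as c. *)
Lemma sum_kept_weight col : (forall x, col x < 9) ->
  \sum_(s < 9) kept_weight col s = 2 * \sum_x scaled x.
Proof.
move=> col9; rewrite /kept_weight (exchange_big_dep predT) //= big_distrr /=.
apply: eq_bigr => x _; under eq_bigl do rewrite inE.
rewrite sum_nat_const; congr (_ * _).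
rewrite -sum1_card big_mkcond /= !big_ord_recl big_ord0 /=.
have := col9 x; move: (col x) => c.
by do 9?[case: c => [//|c]].
Qed.

End Selection.

Import Order.TTheory GRing.Theory Num.Theory.

(** * Polynomial bounds and the encoding *)

Section FromDefs.
Variables (V : finType) (T : tournament V).

(** An obstruction for k = 3 induces a member of T7, isomorphic to itself by the identity; a
    triangle in the image of a 5-set is a directed cycle of length 3. *)
Lemma T7_free_fvs_bounded : T7_free T -> fvs_bounded T 3 setT.
Proof.
move=> free; apply: fvs_boundedI=> X _ [cX noX].
apply: (free _ (induced T X) _ X cX); last by exists id; [exists id|].
split; first by rewrite card_sig -cX; apply: eq_card=> x; rewrite inE.
move=> S cS trS.
have cY : #|val @: S| = 5 by rewrite card_imset //; apply: val_inj.
have YX : val @: S \subset X by apply/subsetP=> _ /imsetP[x _ ->]; apply: valP.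
move: (noX _ YX cY) => /negP; apply.
apply: acyclicI=> _ _ _ /imsetP[x xS ->] /imsetP[y yS ->] /imsetP[z zS ->] xy yz zx.
pose u := exist (fun x => x \in S) x xS; pose v := exist (fun x => x \in S) y yS.
pose r := exist (fun x => x \in S) z zS.
have ne (a c : {x | x \in S}) : T (val (val a)) (val (val c)) -> a != c.
  by move=> ac; apply: contraTneq ac => ->; rewrite arc_irreflexive.
apply: trS; exists [:: u; v; r] => //; apply/andP; split; first by rewrite /= xy yz zx.
by rewrite /= !inE negb_or (ne u v xy) (ne v r yz) eq_sym (ne r u zx).
Qed.

(** By transitivity the first vertex of a directed cycle would dominate every later one, including
    itself. *)
Lemma acyclic_feedback (F : {set V}) : acyclic T (~: F) -> feedback_vertex_set T F.
Proof.
move=> /acyclicP aF [[//|x p] _ /andP[cyc _]].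
have tr : transitive (induced T (~: F)).
  by move=> y x' z xy yz; apply: aF xy yz; apply: valP.
have /allP/(_ x) := order_path_min tr cyc.
by rewrite mem_rcons inE eqxx arc_irreflexive => /(_ isT).
Qed.

End FromDefs.

Definition is_poly (g : nat -> nat) := exists p : {poly nat}, forall x, p.[x]%R = g x.

Lemma is_polyC c : is_poly (fun=> c).
Proof. by exists c%:P%R => x; rewrite hornerC. Qed.

Lemma is_polyX : is_poly id.
Proof. by exists 'X%R => x; rewrite hornerX. Qed.

Lemma is_polyD g h : is_poly g -> is_poly h -> is_poly (fun x => g x + h x).
Proof. by move=> [p Ep] [q Eq]; exists (p + q)%R => x; rewrite hornerD Ep Eq. Qed.

Lemma is_polyM g h : is_poly g -> is_poly h -> is_poly (fun x => g x * h x).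
Proof. by move=> [p Ep] [q Eq]; exists (p * q)%R => x; rewrite hornerM Ep Eq. Qed.

Lemma is_polyS g : is_poly g -> is_poly (fun x => (g x).+1).
Proof. by move=> pg; case: (is_polyD (is_polyC 1) pg) => p Ep; exists p. Qed.

(** The program is fixed, so recursion on it combines finitely many sums and products. *)
Lemma is_poly_cost g h p : is_poly g -> is_poly h -> is_poly (fun x => cost (g x) (h x) p).
Proof.
move=> pg ph; have pe e : is_poly (fun x => expr_bound (g x) e).
  exact: is_polyM (is_polyC _) (is_polyS (is_polyM pg (is_polyC _))).
elim: p => [|a i e|p IHp q IHq|e p IHp q IHq|k e p IHp] /=.
- exact: is_polyC.
- exact/is_polyS/is_polyD.
- exact/is_polyS/is_polyD.
- by apply/is_polyS/is_polyD => //; apply: is_polyD.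
- apply: is_polyS; apply: is_polyD; first exact/is_polyS/is_polyD.
  apply: is_polyD; last exact: is_polyS.
  apply: is_polyM => //; apply: is_polyS; apply: is_polyD => //.
  apply: is_polyS; apply: is_polyD => //; apply: is_polyS; exact: is_polyD.
Qed.

Lemma nth_allpairs_product (A : Type) (B : Type) (F : A -> A -> B) d x0 (s t : seq A) i j :
  i < size s -> j < size t ->
  nth d [seq F x y | x <- s, y <- t] (size t * i + j) = F (nth x0 s i) (nth x0 t j).
Proof.
elim: s i => [//|x s IHs] [|i] /= lti ltj.
  by rewrite muln0 add0n nth_cat size_map ltj (nth_map x0).
rewrite nth_cat size_map ltnNge mulnS -addnA leq_addr /= addKn.
exact: IHs.
Qed.

Lemma prod_bits (I : Type) (r : seq I) (F : I -> nat) :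
  \prod_(x <- r) F x <= 2 ^ \sum_(x <- r) bits (F x).
Proof.
elim/big_ind2: _ => [|x1 x2 y1 y2 h1 h2|x _]; first by [].
  by rewrite expnD leq_mul.
exact/ltnW/ltn_bits.
Qed.

Section Encoding.
Variables (V : finType) (T : tournament V) (w : V -> rat).
Hypothesis w_ge0 : forall v, (0 <= w v)%R.

Let n := #|V|.
Let N := input_size (encode T w).
Let num x := absz (numq (w x)).
Let den x := absz (denq (w x)).
Let D := \prod_x den x.
Let m := load (encode T w).

Lemma input_sizeE : N = (bits n).+1 +
  (\sum_(k <- [seq nat_of_bool (T x y) | x <- enum V, y <- enum V]) (bits k).+1 +
  (\sum_x (bits (num x)).+1 + \sum_x (bits (den x)).+1)).
Proof.
rewrite /N /input_size /encode !big_cons !big_nil !addn0.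
by rewrite !big_map ![index_enum _]unlock.
Qed.

Lemma entry_lt a i : m a i < 2 ^ N.
Proof.
have H (r : seq nat) : r \in encode T w -> nth 0 r i < 2 ^ N.
  move=> rE; have [lt|ge] := ltnP i (size r); last by rewrite nth_default ?expn_gt0.
  apply: leq_trans (ltn_bits _) _; rewrite leq_exp2l //.
  rewrite /N /input_size (big_rem r) //= (big_rem (nth 0 r i)) ?mem_nth //=.
  by lia.
rewrite /m /load; have [lt|ge] := ltnP a (size (encode T w)); first by apply: H; apply: mem_nth.
by rewrite (nth_default [::]) // nth_nil expn_gt0.
Qed.

(** Each vertex contributes a denominator, and every entry has size at least one. *)
Lemma card_le_input : n <= N.
Proof.
rewrite input_sizeE; have : n <= \sum_x (bits (den x)).+1.
  by rewrite /n -sum1_card; apply: leq_sum.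
by lia.
Qed.

Lemma den_gt0 x : 0 < den x.
Proof. by rewrite absz_gt0 denq_neq0. Qed.

Lemma prod_den_le : D <= 2 ^ N.
Proof.
apply: leq_trans (prod_bits _ _) _; rewrite leq_exp2l // input_sizeE.
have : \sum_x bits (den x) <= \sum_x (bits (den x)).+1 by apply: leq_sum.
by lia.
Qed.

Lemma num_lt x : num x < 2 ^ N.
Proof.
have -> : num x = m 2 (rank x); last exact: entry_lt.
by rewrite /m /load /= (nth_map x) ?index_mem ?mem_enum // nth_index ?mem_enum.
Qed.

Lemma load_den x : m 3 (rank x) = den x.
Proof. by rewrite /m /load /= (nth_map x) ?index_mem ?mem_enum // nth_index ?mem_enum. Qed.

Lemma load_num x : m 2 (rank x) = num x.
Proof. by rewrite /m /load /= (nth_map x) ?index_mem ?mem_enum // nth_index ?mem_enum. Qed.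

Lemma load_graph : graph T m.
Proof.
split=> // x y; rewrite /m /load /= cardE.
by rewrite (nth_allpairs_product _ _ x) ?index_mem ?mem_enum // !nth_index ?mem_enum.
Qed.

(** The scaled weights are n <= 2^N numbers, each at most 2^N * 2^N (numerator times common
    denominator); their sum needs 3N bits. The other 8 bits leave room for strict inequality and for
    the constants added to n. *)
Let b := 3 * N + 8.

Lemma bit_bounds : [/\ n + 16 < 2 ^ b, D < 2 ^ b &
  \sum_x scaled num den x < 2 ^ b].
Proof.
have N2 := ltn_expl N (isT : 1 < 2).
have pb : 2 ^ b = 2 ^ N * 2 ^ N * 2 ^ N * 256.
  by rewrite /b expnD !mulSn mul0n addn0 !expnD mulnA.
have gt0 : 0 < 2 ^ N by rewrite expn_gt0.
have nN := card_le_input; have hD := prod_den_le.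
set P := 2 ^ N in N2 pb gt0 hD *.
have PPP : P <= P * P * P by rewrite -mulnA leq_pmulr // muln_gt0 gt0.
split; rewrite pb; [lia | lia |].
have : \sum_x scaled num den x <= \sum_(x : V) P * P.
  apply: leq_sum => x _; rewrite /scaled leq_mul //; first exact/ltnW/num_lt.
  exact: leq_trans (leq_div _ _) hD.
rewrite sum_nat_const -/n => le; apply: leq_ltn_trans le _.
have : n * (P * P) <= P * (P * P) by rewrite leq_mul2r; lia.
by have : 0 < P * P * P by [rewrite !muln_gt0 gt0]; lia.
Qed.

Lemma scaledE x : ((scaled num den x)%:R = w x * D%:R :> rat)%R.
Proof.
have dD : den x %| D by rewrite /D (bigD1 x) //= dvdn_mulr.
have nE : ((num x)%:R = (numq (w x))%:~R :> rat)%R.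
  by rewrite pmulrn /num gez0_abs // numq_ge0.
have dE : ((den x)%:R = (denq (w x))%:~R :> rat)%R.
  by rewrite pmulrn /den gez0_abs // ltW // denq_gt0.
rewrite /scaled natrM natf_div // nE dE mulrCA divq_num_den.
exact: mulrC.
Qed.

End Encoding.

Theorem theorem2 :
  exists (alg : cmd) (p : {poly nat}),
  forall (V : finType) (T : tournament V) (w : V -> rat),
    (forall v : V, (0 <= w v)%R) ->
    T7_free T ->
    exists (m : memory) (t : nat),
      [/\ exec alg (load (encode T w)) m t,
          t <= (p.[input_size (encode T w)])%R,
          feedback_vertex_set T (output V m) &
          (weight w (output V m) <= 7%:R / 9%:R * weight w [set: V])%R].
Proof.
(* The loop bound N + 9 covers the loops over the vertices, the 3 parts and the 9 candidates. *)
have [p pE] : is_poly (fun x => cost (3 * x + 8) (x + 9) main_prog).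
  apply: is_poly_cost; apply: is_polyD (is_polyC _); last exact: is_polyX.
  exact: is_polyM (is_polyC _) is_polyX.
exists (compile main_prog), p => V T w w0 free.
set N := input_size _; set m0 := load _.
pose num x := absz (numq (w x)); pose den x := absz (denq (w x)).
have [nb hD hW] := bit_bounds T w.
have b0 : 0 < 3 * N + 8 by lia.
have nL : #|V| + 9 <= N + 9 by have := card_le_input T w; rewrite -/N; lia.
have bm : bounded (3 * N + 8) m0.
  move=> a i; apply: leq_trans (entry_lt T w a i) _.
  by rewrite leq_exp2l // -/N; lia.
have m5 i : m0 5 i = 0 by rewrite /m0 /load /= nth_nil.
have [m [t [ex le _ _ [col [s [acyc col9 smax out]]]]]] :=
  wp_main b0 nL nb (den_gt0 w) hD hW (T7_free_fvs_bounded free)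
    (load_graph T w) m5 (load_num T w) (load_den T w) bm.
have outE : output V m = ~: kept col s.
  by apply/setP=> x; rewrite !inE -/(rank x) out eqb0 negbK inE.
exists m, t; split=> //; first by rewrite pE.
  by apply: acyclic_feedback; rewrite outE setCK.
pose Dn := \prod_x den x.
have D0 : (0 < Dn%:R :> rat)%R.
  by rewrite ltr0n; apply: prodn_gt0 => x; apply: den_gt0.
have natE (A : {set V}) :
    ((\sum_(x in A) scaled num den x)%:R = weight w A * Dn%:R :> rat)%R.
  by rewrite natr_sum /weight mulr_suml; apply: eq_bigr => x _; rewrite scaledE.
have le9 : 2 * \sum_(x in [set: V]) scaled num den x <= 9 * kept_weight num den col s.
  have -> : \sum_(x in [set: V]) scaled num den x = \sum_x scaled num den x.
    by apply: eq_bigl => x; rewrite inE.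
  rewrite -(sum_kept_weight num den col9).
  have -> : 9 * kept_weight num den col s = \sum_(i < 9) kept_weight num den col s.
    by rewrite sum_nat_const card_ord.
  by apply: leq_sum => i _; apply: smax.
have : (2%:R * weight w [set: V] <= 9%:R * weight w (kept col s))%R.
  rewrite -(ler_pM2r D0) -!mulrA -!natE -!natrM ler_nat; exact: le9.
have -> : weight w [set: V] = (weight w (kept col s) + weight w (output V m))%R.
  rewrite outE /weight (bigID (fun x => x \in kept col s)) /=.
  by congr (_ + _)%R; apply: eq_bigl => x; rewrite !inE.
by move=> ?; lra.
Qed.
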